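(* Let $0<q<1$. For $\operatorname{Re}s>1$, $$\zeta_q(s)=\sum_{j=0}^{\infty}\frac{(-1)^{j+1}}{[2j]!}q^{j(2j-1)}\eta_q(s-2j),\qquad \zeta_q^*(s)=\frac12\sum_{j=0}^{\infty}\frac{(-1)^{j}}{[2j+1]!}q^{j(2j+1)}\eta_q^{*}(s-2j-1).$$ In particular, if $s=2n$ with $n\in\mathbb{N}=\{1,2,\dots\}$, then $$\zeta_q(2n)=\sum_{j=0}^{n}\frac{(-1)^{j+1}}{[2j]!}q^{j(2j-1)}\eta_q(2n-2j),\qquad \zeta_q^*(2n)=\frac12\sum_{j=0}^{n-1}\frac{(-1)^{j}}{[2j+1]!}q^{j(2j+1)}\eta_q^{*}(2n-2j-1).$$
   Context: Fix $0<q<1$. $(x;q)_\infty=\prod_{j\ge 0}(1-xq^j)$, $[n]=\frac{1-q^n}{1-q}$, $[n]!=\prod_{k=1}^n[k]$, $[0]!=1$. $E_q(z)=(-(1-q)z;q)_\infty$. $\mathrm{Sin}_q z=\frac{E_q(iz)-E_q(-iz)}{2i}=\sum_{k\ge0}(-1)^k\frac{q^{k(2k+1)}}{[2k+1]!}z^{2k+1}$ and $\mathrm{Cos}_q z=\frac{E_q(iz)+E_q(-iz)}{2}=\sum_{k\ge0}(-1)^k\frac{q^{k(2k-1)}}{[2k]!}z^{2k}$. All zeros of these functions are real and simple; $(\xi_k)_{k\ge1}$ and $(\eta_k)_{k\ge1}$ denote the positive zeros of $\mathrm{Sin}_q$ and $\mathrm{Cos}_q$ respectively, in increasing order. Primes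 denote ordinary derivatives. For $\operatorname{Re}s>1$, $$\zeta_q(s)=\sum_{k=1}^{\infty}\frac{\mathrm{Cos}_q\xi_k}{\mathrm{Sin}_q'\xi_k}\frac1{\xi_k^s},\qquad \zeta_q^*(s)=-\sum_{k=1}^{\infty}\frac{\mathrm{Sin}_q\eta_k}{\mathrm{Cos}_q'\eta_k}\frac1{\eta_k^s},$$ and for $s\in\mathbb{C}$, $$\eta_q(s)=-\sum_{k=1}^\infty\frac{1}{\xi_k^s}\frac{1}{\mathrm{Sin}_q'\xi_k},\qquad \eta_q^*(s)=-\sum_{k=1}^\infty\frac{1}{\eta_k^s}\frac{1}{\mathrm{Cos}_q'\eta_k}.$$
   Formalization: The factor 1/2 in both formulas for ζ_q^* is dropped: with the given definitions, inserting the series of Sin_q gives the sums without 1/2, and since ζ_q^*(s) > 0 for real s > 1 the printed version is false. *)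

(* Defs.v *)
(* Stdlib reals with Coquelicot: complex numbers [C], series, [C_derive]. *)
From Stdlib Require Import Reals.
From Coquelicot Require Import Coquelicot.

Open Scope R_scope.

(* Limits and sums of complex sequences, as total functions; they are the
   actual limit or sum whenever it exists. *)
Definition CLim_seq (u : nat -> C) : C :=
  (real (Lim_seq (fun n => Re (u n))), real (Lim_seq (fun n => Im (u n)))).

Definition CSeries (a : nat -> C) : C :=
  (Series (fun n => Re (a n)), Series (fun n => Im (a n))).

Definition ex_Cseries (a : nat -> C) : Prop :=
  @ex_series C_AbsRing C_NormedModule a.

Definition is_Cseries (a : nat -> C) (l : C) : Prop :=
  @is_series C_AbsRing C_NormedModule a l.

Definition Cexp (z : C) : C :=
  (exp (Re z) * cos (Im z), exp (Re z) * sin (Im z)).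

(* x ^ s for x > 0, with the real logarithm of x. *)
Definition Rcpow (x : R) (s : C) : C := Cexp (Cmult s (RtoC (ln x))).

(* (x; q)_n and (x; q)_oo *)
Fixpoint qpoch (q : R) (x : C) (n : nat) : C :=
  match n with
  | O => RtoC 1
  | S m => Cmult (qpoch q x m) (Cminus (RtoC 1) (Cmult x (RtoC (q ^ m))))
  end.

Definition qpoch_inf (q : R) (x : C) : C := CLim_seq (qpoch q x).

Definition qnum (q : R) (n : nat) : R := (1 - q ^ n) / (1 - q).

Fixpoint qfact (q : R) (n : nat) : R :=
  match n with
  | O => 1
  | S m => qfact q m * qnum q (S m)
  end.

Definition E_q (q : R) (z : C) : C :=
  qpoch_inf q (Copp (Cmult (RtoC (1 - q)) z)).

Definition Sin_q (q : R) (z : C) : C :=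
  ((E_q q (Ci * z) - E_q q (- (Ci * z))) / (RtoC 2 * Ci))%C.

Definition Cos_q (q : R) (z : C) : C :=
  ((E_q q (Ci * z) + E_q q (- (Ci * z))) / RtoC 2)%C.

(* [u] lists the positive zeros of [f] in increasing order; [u k] is the zero
   numbered k + 1 in the usual indexing from 1. *)
Definition positive_zeros (f : C -> C) (u : nat -> R) : Prop :=
  (forall k, u k < u (S k)) /\
  (forall x : R, (0 < x /\ f (RtoC x) = RtoC 0) <-> exists k, u k = x).

(* In the sums below, [xi] and [eta] are the positive zeros of [Sin_q q] and
   [Cos_q q] respectively. *)
Definition zeta_q_term (q : R) (xi : nat -> R) (s : C) (k : nat) : C :=
  (Cos_q q (RtoC (xi k)) / C_derive (Sin_q q) (RtoC (xi k))
     * (RtoC 1 / Rcpow (xi k) s))%C.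

Definition zeta_q (q : R) (xi : nat -> R) (s : C) : C :=
  CSeries (zeta_q_term q xi s).

Definition zeta_q_star_term (q : R) (eta : nat -> R) (s : C) (k : nat) : C :=
  (Sin_q q (RtoC (eta k)) / C_derive (Cos_q q) (RtoC (eta k))
     * (RtoC 1 / Rcpow (eta k) s))%C.

Definition zeta_q_star (q : R) (eta : nat -> R) (s : C) : C :=
  Copp (CSeries (zeta_q_star_term q eta s)).

Definition eta_q_term (q : R) (xi : nat -> R) (s : C) (k : nat) : C :=
  (RtoC 1 / Rcpow (xi k) s * (RtoC 1 / C_derive (Sin_q q) (RtoC (xi k))))%C.

Definition eta_q (q : R) (xi : nat -> R) (s : C) : C :=
  Copp (CSeries (eta_q_term q xi s)).

Definition eta_q_star_term (q : R) (eta : nat -> R) (s : C) (k : nat) : C :=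
  (RtoC 1 / Rcpow (eta k) s * (RtoC 1 / C_derive (Cos_q q) (RtoC (eta k))))%C.

Definition eta_q_star (q : R) (eta : nat -> R) (s : C) : C :=
  Copp (CSeries (eta_q_star_term q eta s)).

(* The j-th terms of the expansions of zeta_q(s) and zeta_q^*(s).  At j = 0
   the truncated [2 * j - 1] is harmless, being multiplied by j.

   The second expansion is obtained by inserting the power series of [Sin_q]
   in [zeta_q_star_term] and exchanging the sums.  With [eta_q_star]
   normalised as above it carries no factor 1/2, although one is sometimes
   printed: for instance zeta_q^*(2) = eta_q^*(1) = 1/2. *)
Definition zeta_q_exp (q : R) (xi : nat -> R) (s : C) (j : nat) : C :=
  (RtoC ((-1) ^ (j + 1) / qfact q (2 * j) * q ^ (j * (2 * j - 1)))
     * eta_q q xi (s - RtoC (INR (2 * j))))%C.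

Definition zeta_q_star_exp (q : R) (eta : nat -> R) (s : C) (j : nat) : C :=
  (RtoC ((-1) ^ j / qfact q (2 * j + 1) * q ^ (j * (2 * j + 1)))
     * eta_q_star q eta (s - RtoC (INR (2 * j + 1))))%C.

(* Main.v *)
(* On the imaginary axis E_q(ix) = |E_q(ix)| exp(i phi(x)) with
   phi(x) = sum_j atan((1-q) q^j x), so that Sin_q = |E_q| sin phi and
   Cos_q = |E_q| cos phi: the k-th positive zeros are the solutions of
   phi(x) = k pi, respectively phi(x) = (k - 1/2) pi, and the derivative at a
   zero is +-|E_q(ix)| phi'(x).  Away from x = 0, x phi'(x) =
   sum_j t_j / (1 + t_j^2), with t_j = (1-q) q^j x, stays between two positive
   constants, and E_q(x) <= C |E_q(ix)|; hence inserting the power series of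
   Cos_q (or Sin_q) at the zeros gives an absolutely convergent double series
   dominated by sum_k x_k^(1 - Re s), where x_(k+1) >= x_k / q.  Exchanging the
   sums gives the expansions.

   They terminate because sum_k x_k^p / f'(x_k) = 0 for f = Sin_q and even
   p >= 2, and for f = Cos_q and odd p >= 1.  For the truncated products, which
   are polynomials with real simple zeros, this is the vanishing of the sum of
   the residues of x^p / f; the infinite case follows by dominated convergence,
   the zeros of the truncations converging to those of f. *)
Require Import Defs.
From Stdlib Require Import Reals Lra Lia Psatz Arith ZArith ClassicalEpsilon.
From Coquelicot Require Import Coquelicot.
From mathcomp Require all_boot all_algebra Rstruct ring.

Open Scope R_scope.

(** * Partial sums and dominated convergence *)

(** All analysis takes place on the positive real axis; [x ^ s] enters only through the real and
    imaginary parts of its inverse, treated as bounded real weights. Both functions are handled at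
    once as [|E_q| sin (phi + delta)], with [delta] equal to 0 for [Sin_q] and [PI / 2] for [Cos_q].
    The bounds on x phi'(x) come from reading the sum of t / (1 + t^2) over a geometric grid as a
    Riemann sum: each term is comparable to atan (t / q) - atan t, and these increments telescope.
    The obstacle is uniformity in the truncations. With N factors, the phase saturates at N pi / 2,
    and x phi'(x) tends to 0 there. Taking N = 2M + 1 for [Sin_q] and N = 2M for [Cos_q] puts the
    M-th and largest zero exactly pi / 2 below saturation, which keeps x phi'(x) bounded below. The
    truncations are polynomials in x^2, up to a factor x, so positive zeros suffice; the residue sum
    is then a coefficient of a Lagrange interpolant. Product and power series are identified by
    iterating E(x) = (1 + (1 - q) x) E(q x). *)

Fixpoint psum (f : nat -> R) (n : nat) : R :=
  match n with
  | O => 0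
  | S m => psum f m + f m
  end.

Lemma psum_sum_n (f : nat -> R) (n : nat) : psum f (S n) = sum_n f n.
Proof.
  induction n as [|n IH].
  - rewrite sum_O. simpl. ring.
  - rewrite sum_Sn, <- IH. reflexivity.
Qed.

Lemma psum_ext (f g : nat -> R) (n : nat) :
  (forall k, (k < n)%nat -> f k = g k) -> psum f n = psum g n.
Proof.
  intros H. induction n as [|n IH]; simpl; [reflexivity|].
  rewrite IH, H; [reflexivity|lia|intros; apply H; lia].
Qed.

Lemma psum_le (f g : nat -> R) (n : nat) :
  (forall k, (k < n)%nat -> f k <= g k) -> psum f n <= psum g n.
Proof.
  intros H. induction n as [|n IH]; simpl; [lra|].
  apply Rplus_le_compat; [apply IH; intros|]; apply H; lia.
Qed.

Lemma psum_scal (c : R) (f : nat -> R) (n : nat) :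
  psum (fun k => c * f k) n = c * psum f n.
Proof. induction n as [|n IH]; simpl; [|rewrite IH]; ring. Qed.

Lemma psum_minus (f g : nat -> R) (n : nat) :
  psum (fun k => f k - g k) n = psum f n - psum g n.
Proof. induction n as [|n IH]; simpl; [|rewrite IH]; ring. Qed.

Lemma psum_const (c : R) (n : nat) : psum (fun _ => c) n = INR n * c.
Proof.
  induction n as [|n IH]; [simpl; ring|].
  rewrite S_INR; cbn [psum]; rewrite IH; ring.
Qed.

Lemma psum_telescope (f : nat -> R) (n : nat) :
  psum (fun k => f k - f (S k)) n = f O - f n.
Proof. induction n as [|n IH]; simpl; [|rewrite IH]; ring. Qed.

Lemma psum_abs (f : nat -> R) (n : nat) :
  Rabs (psum f n) <= psum (fun k => Rabs (f k)) n.
Proof.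
  induction n as [|n IH]; simpl; [rewrite Rabs_R0; lra|].
  eapply Rle_trans; [apply Rabs_triang|lra].
Qed.

Lemma psum_incr (f : nat -> R) (m n : nat) :
  (forall k, 0 <= f k) -> (m <= n)%nat -> psum f m <= psum f n.
Proof.
  intros Hf H. induction H as [|n H IH]; [lra|]. simpl. specialize (Hf n). lra.
Qed.

Lemma psum_lim (f : nat -> R) (l : R) :
  is_series f l <-> is_lim_seq (psum f) l.
Proof.
  rewrite is_lim_seq_incr_1.
  split; intros H.
  - apply is_lim_seq_ext with (sum_n f); [intros; symmetry; apply psum_sum_n|exact H].
  - change (is_lim_seq (sum_n f) l).
    apply (is_lim_seq_ext (fun n => psum f (S n)) (sum_n f));
      [intros; apply psum_sum_n|exact H].
Qed.

Lemma psum_le_Series (f : nat -> R) (n : nat) :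
  (forall k, 0 <= f k) -> ex_series f -> psum f n <= Series f.
Proof.
  intros Hf Hex. apply Series_correct, psum_lim in Hex.
  apply (is_lim_seq_incr_compare _ _ Hex).
  intros k. apply psum_incr; [assumption|lia].
Qed.

Lemma ex_series_abs_le (f M : nat -> R) :
  (forall k, Rabs (f k) <= M k) -> ex_series M -> ex_series f.
Proof. intros H HM. exact (ex_series_le f M H HM). Qed.

Lemma Series_abs_le (f M : nat -> R) :
  (forall k, Rabs (f k) <= M k) -> ex_series M -> Rabs (Series f) <= Series M.
Proof.
  intros H HM.
  eapply Rle_trans; [apply Series_Rabs|apply Series_le; [|exact HM]].
  - apply (ex_series_abs_le _ M); [|exact HM]. intros k. rewrite Rabs_Rabsolu. apply H.
  - intros k. split; [apply Rabs_pos|apply H].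
Qed.

(* Split at [k] past which the tail of [Series M] is small. *)
Lemma tannery (u : nat -> nat -> R) (l M : nat -> R) (n0 : nat) :
  ex_series M ->
  (forall n k, (n0 <= n)%nat -> Rabs (u n k) <= M k) ->
  (forall k, is_lim_seq (fun n => u n k) (l k)) ->
  is_lim_seq (fun n => Series (u n)) (Series l).
Proof.
  intros HM Hu Hl.
  assert (HlM : forall k, Rabs (l k) <= M k).
  { intros k.
    apply (is_lim_seq_le_loc (fun n => Rabs (u n k)) (fun _ => M k)
             (Rabs (l k)) (M k)).
    - exists n0. intros n Hn. now apply Hu.
    - apply (is_lim_seq_abs _ (Finite (l k))), Hl.
    - apply is_lim_seq_const. }
  assert (Hdiff : forall K n, (n0 <= n)%nat ->
    Rabs (Series (u n) - Series l)
      <= Rabs (psum (fun k => u n k - l k) K) + 2 * (Series M - psum M K)).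
  { intros K n Hn.
    assert (Eu : ex_series (u n)) by (apply (ex_series_abs_le _ M); auto).
    assert (El : ex_series l) by (apply (ex_series_abs_le _ M); auto).
    (* Splitting a series needs a nonempty head, so [K = 0] is bounded directly. *)
    destruct K as [|K].
    - simpl. rewrite Rabs_R0.
      assert (Rabs (Series (u n)) <= Series M) by (apply Series_abs_le; auto).
      assert (Rabs (Series l) <= Series M) by (apply Series_abs_le; auto).
      unfold Rminus at 1.
      eapply Rle_trans; [apply Rabs_triang|]. rewrite Rabs_Ropp. lra.
    - rewrite psum_minus.
      rewrite (Series_incr_n (u n) (S K)), (Series_incr_n l (S K)),
        (Series_incr_n M (S K)) by (auto; lia).
      simpl pred. rewrite <- !sum_n_Reals, <- !psum_sum_n.
      assert (HMK : ex_series (fun k => M (S K + k)%nat))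
        by (now apply (ex_series_incr_n M (S K))).
      assert (Rabs (Series (fun k => u n (S K + k)%nat))
              <= Series (fun k => M (S K + k)%nat)) by (apply Series_abs_le; auto).
      assert (Rabs (Series (fun k => l (S K + k)%nat))
              <= Series (fun k => M (S K + k)%nat)) by (apply Series_abs_le; auto).
      set (A := Series (fun k => u n (S K + k)%nat)) in *.
      set (B := Series (fun k => l (S K + k)%nat)) in *.
      replace (psum (u n) (S K) + A - (psum l (S K) + B)) with
        ((psum (u n) (S K) - psum l (S K)) + (A - B)) by ring.
      eapply Rle_trans; [apply Rabs_triang|].
      assert (Rabs (A - B) <= Rabs A + Rabs B).
      { unfold Rminus. rewrite <- (Rabs_Ropp B). apply Rabs_triang. }
      lra. }
  assert (Hps : forall K, is_lim_seq (fun n => psum (fun k => u n k - l k) K) 0).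
  { induction K as [|K IH]; simpl; [apply is_lim_seq_const|].
    replace (Finite 0) with (Finite (0 + (l K - l K))) by (f_equal; ring).
    apply (is_lim_seq_plus' _ _ _ _ IH).
    apply (is_lim_seq_minus' _ _ _ _ (Hl K)), is_lim_seq_const. }
  apply is_lim_seq_spec. intros eps.
  assert (HMl := proj1 (psum_lim _ _) (Series_correct _ HM)).
  apply is_lim_seq_spec in HMl.
  (* The tail counts twice in [Hdiff], once for [u n] and once for [l]; a quarter of [eps] leaves
     half for the head. *)
  destruct (HMl (mkposreal _ (is_pos_div_2 (pos_div_2 eps)))) as [K HK].
  specialize (HK K (Nat.le_refl K)). simpl in HK.
  specialize (Hps K). apply is_lim_seq_spec in Hps.
  destruct (Hps (pos_div_2 eps)) as [n1 Hn1].
  exists (Nat.max n0 n1). intros n Hn.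
  specialize (Hn1 n ltac:(lia)). rewrite Rminus_0_r in Hn1. simpl in Hn1.
  apply Rabs_def2 in HK.
  eapply Rle_lt_trans; [apply (Hdiff K); lia|]. lra.
Qed.

(** Fubini by dominated convergence: the partial sums over [j], seen as sequences in [k], are all
    dominated by [M], and their length tends to infinity. *)
Lemma Series_exchange (a : nat -> nat -> R) (l M : nat -> R) :
  ex_series M ->
  (forall n k, psum (fun j => Rabs (a j k)) n <= M k) ->
  (forall k, is_series (fun j => a j k) (l k)) ->
  is_series (fun j => Series (a j)) (Series l).
Proof.
  intros HM Ha Hl.
  assert (Hex : forall j, ex_series (a j)).
  { intros j. apply (ex_series_abs_le _ M); [|exact HM]. intros k.
    eapply Rle_trans; [|apply (Ha (S j) k)]. simpl.
    assert (0 <= psum (fun j => Rabs (a j k)) j); [|lra].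
    rewrite <- (Rmult_0_r (INR j)), <- psum_const.
    apply psum_le. intros; apply Rabs_pos. }
  apply psum_lim.
  apply is_lim_seq_ext with (fun n => Series (fun k => psum (fun j => a j k) n)).
  - induction n as [|n IH]; simpl.
    + apply is_series_unique, psum_lim.
      apply is_lim_seq_ext with (fun _ => 0); [|apply is_lim_seq_const].
      intros n. rewrite psum_const. ring.
    + rewrite Series_plus, IH; auto.
      apply (ex_series_abs_le _ M); [|exact HM]. intros k.
      eapply Rle_trans; [apply psum_abs|apply Ha].
  - apply (tannery _ l M 0 HM).
    + intros n k _. eapply Rle_trans; [apply psum_abs|apply Ha].
    + intros k. apply psum_lim, Hl.
Qed.

Definition trunc (f : nat -> R) (n k : nat) : R := if lt_dec k n then f k else 0.

Lemma Series_trunc (f : nat -> R) (n : nat) : Series (trunc f n) = psum f n.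
Proof.
  apply is_series_unique, psum_lim.
  apply is_lim_seq_ext_loc with (fun _ => psum f n); [|apply is_lim_seq_const].
  exists n. intros m Hm. induction Hm as [|m Hm IH].
  - apply psum_ext. intros k Hk. unfold trunc. destruct (lt_dec k n); [reflexivity|lia].
  - simpl. rewrite <- IH. unfold trunc at 1. destruct (lt_dec m n); [lia|ring].
Qed.

(** Extension by zero turns sums of growing length into series. Since [n <= N n], every index is
    eventually inside the range, so the pointwise limits are unchanged. *)
Lemma tannery_psum (u : nat -> nat -> R) (l M : nat -> R) (N : nat -> nat) (n0 : nat) :
  ex_series M -> (forall k, 0 <= M k) ->
  (forall n, (n <= N n)%nat) ->
  (forall n k, (n0 <= n)%nat -> (k < N n)%nat -> Rabs (u n k) <= M k) ->
  (forall k, is_lim_seq (fun n => u n k) (l k)) ->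
  is_lim_seq (fun n => psum (u n) (N n)) (Series l).
Proof.
  intros HM HM0 HN Hu Hl.
  apply is_lim_seq_ext with (fun n => Series (trunc (u n) (N n)));
    [intros; apply Series_trunc|].
  apply (tannery _ l M n0 HM).
  - intros n k Hn. unfold trunc. destruct (lt_dec k (N n)); [auto|].
    rewrite Rabs_R0. apply HM0.
  - intros k. apply is_lim_seq_ext_loc with (fun n => u n k); [|apply Hl].
    exists (S k). intros n Hn. unfold trunc.
    destruct (lt_dec k (N n)) as [|H]; [reflexivity|]. specialize (HN n). lia.
Qed.

(** * Polar form of E_q on the imaginary axis *)

(** [E_q z] is the product over [j] of the factors [1 + qb q j * z]. *)
Definition qb (q : R) (j : nat) : R := (1 - q) * q ^ j.

Definition qsum (q : R) (g : R -> R) (N : nat) (x : R) : R :=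
  psum (fun j => g (qb q j * x)) N.

Definition qseries (q : R) (g : R -> R) (x : R) : R :=
  Series (fun j => g (qb q j * x)).

(** The linear bound dominates the sum of [g (qb q j * x)] by a geometric series, uniformly for
    bounded [x]. *)
Definition tame (g : R -> R) : Prop :=
  (forall t, continuity_pt g t) /\ (forall t, Rabs (g t) <= Rabs t).

(** The logarithm of the modulus of [1 + i t], whose argument is [atan t]. *)
Definition half_ln (t : R) : R := ln (1 + t * t) / 2.
(** This is [t] times the derivative of [atan], so its sum over the grid is x phi'(x). It is also
    the derivative of [half_ln]. *)
Definition cauchy_kernel (t : R) : R := t / (1 + t * t).

Lemma exp_half_ln (t : R) : exp (half_ln t) = sqrt (1 + t * t).
Proof.
  assert (H : 0 < 1 + t * t) by nra.
  symmetry. apply sqrt_lem_1; [lra|apply Rlt_le, exp_pos|].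
  rewrite <- exp_plus. unfold half_ln.
  replace (ln (1 + t * t) / 2 + ln (1 + t * t) / 2) with (ln (1 + t * t)) by field.
  now apply exp_ln.
Qed.

Lemma half_ln_opp (t : R) : half_ln (- t) = half_ln t.
Proof. unfold half_ln. do 3 f_equal. ring. Qed.

Lemma half_ln_nonneg (t : R) : 0 <= half_ln t.
Proof.
  unfold half_ln. assert (0 <= ln (1 + t * t)); [|lra].
  rewrite <- ln_1. apply ln_le; nra.
Qed.

Lemma atan_lipschitz (s t : R) : s <= t -> 0 <= atan t - atan s <= t - s.
Proof.
  intros [H| ->]; [|lra].
  destruct (MVT_cor2 atan (fun t => / (1 + t ^ 2)) s t H) as (c & E & _).
  { intros c _. apply derivable_pt_lim_atan. }
  rewrite E. assert (H1 : 1 <= 1 + c ^ 2) by nra.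
  assert (0 < / (1 + c ^ 2)) by (apply Rinv_0_lt_compat; lra).
  assert (/ (1 + c ^ 2) <= 1) by (rewrite <- Rinv_1; apply Rinv_le_contravar; lra).
  nra.
Qed.

Lemma tame_atan : tame atan.
Proof.
  split.
  - intros t. apply derivable_continuous_pt. exists (/ (1 + t ^ 2)).
    apply derivable_pt_lim_atan.
  - intros t. destruct (Rle_dec 0 t) as [H|H].
    + pose proof (atan_lipschitz 0 t H) as H1. rewrite atan_0 in H1.
      rewrite !Rabs_pos_eq; lra.
    + pose proof (atan_lipschitz t 0 ltac:(lra)) as H1. rewrite atan_0 in H1.
      rewrite !Rabs_left1; lra.
Qed.

Lemma tame_half_ln : tame half_ln.
Proof.
  split.
  - intros t. unfold half_ln. apply continuity_pt_filterlim.
    apply (ex_derive_continuous (fun t => ln (1 + t * t) / 2)).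
    auto_derive. nra.
  - intros t. rewrite Rabs_pos_eq by apply half_ln_nonneg.
    (* After exponentiation the claim is sqrt (1 + t^2) <= 1 + |t| <= exp |t|. *)
    rewrite <- (ln_exp (Rabs t)), <- (ln_exp (half_ln t)).
    apply ln_le; [apply exp_pos|]. rewrite exp_half_ln.
    pose proof (exp_ineq1_le (Rabs t)). pose proof (Rabs_pos t).
    eapply Rle_trans; [|eassumption].
    rewrite <- (sqrt_Rsqr (1 + Rabs t)) by lra.
    apply sqrt_le_1_alt. unfold Rsqr.
    assert (t * t = Rabs t * Rabs t) by (rewrite <- Rabs_mult, Rabs_pos_eq; nra).
    nra.
Qed.

Lemma tame_cauchy_kernel : tame cauchy_kernel.
Proof.
  split.
  - intros t. unfold cauchy_kernel. apply continuity_pt_filterlim.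
    apply (ex_derive_continuous (fun t => t / (1 + t * t))).
    auto_derive. nra.
  - intros t. unfold cauchy_kernel, Rdiv. rewrite Rabs_mult.
    rewrite <- (Rmult_1_r (Rabs t)) at 2.
    apply Rmult_le_compat_l; [apply Rabs_pos|].
    rewrite Rabs_pos_eq by (apply Rlt_le, Rinv_0_lt_compat; nra).
    rewrite <- Rinv_1. apply Rinv_le_contravar; nra.
Qed.

Section Base.

Context (q : R) (Hq : 0 < q < 1).

Lemma qb_pos (j : nat) : 0 < qb q j.
Proof. apply Rmult_lt_0_compat; [lra|apply pow_lt; lra]. Qed.

Lemma qb_S (j : nat) : qb q (S j) = q * qb q j.
Proof. unfold qb. simpl. ring. Qed.

Lemma qb_series : is_series (qb q) 1.
Proof.
  replace 1 with ((1 - q) * / (1 - q)) by (field; lra).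
  apply (is_series_scal_l (1 - q) (fun j => q ^ j)), is_series_geom.
  rewrite Rabs_pos_eq; lra.
Qed.

Lemma ex_qb_scal (X : R) : ex_series (fun j => qb q j * X).
Proof.
  apply (ex_series_scal_r X (qb q)). exists 1. apply qb_series.
Qed.

Lemma tame_bound (g : R -> R) (j : nat) (x X : R) :
  tame g -> Rabs x <= X -> Rabs (g (qb q j * x)) <= qb q j * X.
Proof.
  intros [_ H] HX. eapply Rle_trans; [apply H|].
  pose proof (qb_pos j). rewrite Rabs_mult, (Rabs_pos_eq (qb q j)) by lra.
  apply Rmult_le_compat_l; lra.
Qed.

Lemma ex_qseries (g : R -> R) (x : R) :
  tame g -> ex_series (fun j => g (qb q j * x)).
Proof.
  intros Hg. apply (ex_series_abs_le _ (fun j => qb q j * Rabs x)).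
  - intros j. apply tame_bound; [assumption|lra].
  - apply ex_qb_scal.
Qed.

Lemma lim_seq_bound (x : nat -> R) (x0 : R) :
  is_lim_seq x x0 ->
  exists n0, forall n, (n0 <= n)%nat -> Rabs (x n) <= Rabs x0 + 1.
Proof.
  intros H. apply is_lim_seq_spec in H.
  destruct (H (mkposreal 1 Rlt_0_1)) as [n0 Hn0]. exists n0. intros n Hn.
  specialize (Hn0 n Hn). simpl in Hn0.
  pose proof (Rabs_triang (x n - x0) x0) as T.
  replace (x n - x0 + x0) with (x n) in T by ring. lra.
Qed.

Lemma tame_lim (g : R -> R) (j : nat) (x : nat -> R) (x0 : R) :
  tame g -> is_lim_seq x x0 ->
  is_lim_seq (fun n => g (qb q j * x n)) (g (qb q j * x0)).
Proof.
  intros [Hg _] Hx.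
  apply (is_lim_seq_continuous g (fun n => qb q j * x n) (qb q j * x0)); [apply Hg|].
  apply (is_lim_seq_scal_l x (qb q j) x0), Hx.
Qed.

(** The number of factors and the point vary together, because the zeros of the truncations move
    with [N]. *)
Lemma qsum_lim (g : R -> R) (N : nat -> nat) (x : nat -> R) (x0 : R) :
  tame g -> (forall n, (n <= N n)%nat) -> is_lim_seq x x0 ->
  is_lim_seq (fun n => qsum q g (N n) (x n)) (qseries q g x0).
Proof.
  intros Hg HN Hx. destruct (lim_seq_bound _ _ Hx) as [n0 Hn0].
  apply (tannery_psum (fun n j => g (qb q j * x n)) (fun j => g (qb q j * x0))
           (fun j => qb q j * (Rabs x0 + 1)) N n0); auto.
  - apply ex_qb_scal.
  - intros j. pose proof (qb_pos j). pose proof (Rabs_pos x0). nra.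
  - intros n j Hn _. apply tame_bound; auto.
  - intros j. now apply tame_lim.
Qed.

Lemma qseries_lim (g : R -> R) (x : nat -> R) (x0 : R) :
  tame g -> is_lim_seq x x0 ->
  is_lim_seq (fun n => qseries q g (x n)) (qseries q g x0).
Proof.
  intros Hg Hx. destruct (lim_seq_bound _ _ Hx) as [n0 Hn0].
  apply (tannery (fun n j => g (qb q j * x n)) (fun j => g (qb q j * x0))
           (fun j => qb q j * (Rabs x0 + 1)) n0); auto.
  - apply ex_qb_scal.
  - intros n j Hn. apply tame_bound; auto.
  - intros j. now apply tame_lim.
Qed.

Lemma qsum_S (g : R -> R) (N : nat) (x : R) :
  qsum q g (S N) x = qsum q g N x + g (qb q N * x).
Proof. reflexivity. Qed.

Definition modulus (x : R) : R := exp (qseries q half_ln x).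
Definition phase (x : R) : R := qseries q atan x.

(** The factors are [1 + i t] with [t = qb q j * x]. Their arguments are added without reduction
    modulo 2 pi, so [qsum q atan] is a continuous lift of the argument and can count zeros. *)
Lemma qpoch_imag (x : R) (N : nat) :
  qpoch q (- (RtoC (1 - q) * (Ci * RtoC x)))%C N
    = (exp (qsum q half_ln N x) * cos (qsum q atan N x),
       exp (qsum q half_ln N x) * sin (qsum q atan N x)).
Proof.
  induction N as [|N IH].
  - unfold qsum; simpl. rewrite exp_0, cos_0, sin_0.
    unfold RtoC. f_equal; ring.
  - simpl qpoch. rewrite IH, !qsum_S.
    set (t := qb q N * x).
    rewrite exp_plus, cos_plus, sin_plus, cos_atan, sin_atan, exp_half_ln.
    unfold Rsqr. assert (Ht : 0 < sqrt (1 + t * t)) by (apply sqrt_lt_R0; nra).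
    unfold Cmult, Cminus, Cplus, Copp, RtoC, Ci; simpl.
    f_equal; field_simplify; try lra; unfold t, qb; ring.
Qed.

Lemma E_q_imag (x : R) :
  E_q q (Ci * RtoC x)%C
    = (modulus x * cos (phase x), modulus x * sin (phase x)).
Proof.
  unfold E_q, qpoch_inf, CLim_seq.
  assert (Hm : is_lim_seq (fun n => exp (qsum q half_ln n x)) (modulus x)).
  { apply (is_lim_seq_continuous exp _ (qseries q half_ln x));
      [apply derivable_continuous, derivable_exp|].
    apply (qsum_lim half_ln (fun n => n) (fun _ => x)); auto using tame_half_ln.
    apply is_lim_seq_const. }
  assert (Hp : is_lim_seq (fun n => qsum q atan n x) (phase x)).
  { apply (qsum_lim atan (fun n => n) (fun _ => x)); auto using tame_atan.
    apply is_lim_seq_const. }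
  f_equal.
  - rewrite (is_lim_seq_unique _ (modulus x * cos (phase x))); [reflexivity|].
    apply is_lim_seq_ext with
      (fun n => exp (qsum q half_ln n x) * cos (qsum q atan n x)).
    { intros n. now rewrite qpoch_imag. }
    apply (is_lim_seq_mult' _ _ _ _ Hm).
    apply (is_lim_seq_continuous cos _ (phase x)); [apply continuity_cos|exact Hp].
  - rewrite (is_lim_seq_unique _ (modulus x * sin (phase x))); [reflexivity|].
    apply is_lim_seq_ext with
      (fun n => exp (qsum q half_ln n x) * sin (qsum q atan n x)).
    { intros n. now rewrite qpoch_imag. }
    apply (is_lim_seq_mult' _ _ _ _ Hm).
    apply (is_lim_seq_continuous sin _ (phase x)); [apply continuity_sin|exact Hp].
Qed.

Lemma modulus_opp (x : R) : modulus (- x) = modulus x.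
Proof.
  unfold modulus, qseries. f_equal. apply Series_ext. intros j.
  rewrite <- (half_ln_opp (qb q j * x)). f_equal. ring.
Qed.

Lemma phase_opp (x : R) : phase (- x) = - phase x.
Proof.
  unfold phase, qseries. rewrite <- Series_opp. apply Series_ext. intros j.
  rewrite <- atan_opp. f_equal. ring.
Qed.

Lemma E_q_imag_opp (x : R) :
  E_q q (- (Ci * RtoC x))%C
    = (modulus x * cos (phase x), - (modulus x * sin (phase x))).
Proof.
  replace (- (Ci * RtoC x))%C with (Ci * RtoC (- x))%C by (rewrite RtoC_opp; ring).
  rewrite E_q_imag, modulus_opp, phase_opp, cos_neg, sin_neg. f_equal. ring.
Qed.

Lemma Sin_q_real (x : R) : Sin_q q (RtoC x) = RtoC (modulus x * sin (phase x)).
Proof.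
  unfold Sin_q. rewrite E_q_imag, E_q_imag_opp.
  unfold Cdiv, Cinv, Cmult, Cminus, Cplus, Copp, RtoC, Ci; simpl.
  f_equal; field.
Qed.

Lemma Cos_q_real (x : R) : Cos_q q (RtoC x) = RtoC (modulus x * cos (phase x)).
Proof.
  unfold Cos_q. rewrite E_q_imag, E_q_imag_opp.
  unfold Cdiv, Cinv, Cmult, Cminus, Cplus, Copp, RtoC, Ci; simpl.
  f_equal; field.
Qed.

End Base.

(** * Phase, modulus and their truncations *)

Lemma cauchy_kernel_nonneg (t : R) : 0 <= t -> 0 <= cauchy_kernel t.
Proof. intros H. apply Rle_mult_inv_pos; nra. Qed.

Lemma atan_nonneg (t : R) : 0 <= t -> 0 <= atan t.
Proof. intros H. pose proof (atan_lipschitz 0 t H). rewrite atan_0 in *. lra. Qed.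

(** The square of the left side is exactly (1 + t^2) (1 + 2 c) with [c = cauchy_kernel t], and 1 + 2
    c <= exp (2 c). *)
Lemma one_plus_le (t : R) : 0 <= t -> 1 + t <= exp (half_ln t + cauchy_kernel t).
Proof.
  intros Ht. rewrite exp_plus, exp_half_ln.
  apply Rsqr_incr_0_var.
  2: { apply Rmult_le_pos; [apply sqrt_pos|apply Rlt_le, exp_pos]. }
  rewrite Rsqr_mult, Rsqr_sqrt by nra.
  unfold Rsqr at 2. rewrite <- exp_plus.
  pose proof (exp_ineq1_le (cauchy_kernel t + cauchy_kernel t)) as H.
  apply Rle_trans with ((1 + t * t) * (1 + (cauchy_kernel t + cauchy_kernel t))).
  - right. unfold cauchy_kernel, Rsqr. field. nra.
  - apply Rmult_le_compat_l; [nra|exact H].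
Qed.

Section Bounds.

Context (q : R) (Hq : 0 < q < 1).

Notation b := (qb q).
Let b_pos := qb_pos q Hq.

(** Mean value theorem on an interval of length (1 - q) / q times [t]: for c between [t] and
    [t / q], 1 + c^2 lies between 1 + t^2 and (1 + t^2) / q^2. *)
Lemma atan_kernel_bounds (t : R) : 0 < t ->
  q * (1 - q) * cauchy_kernel t <= atan (t / q) - atan t
    <= (1 - q) / q * cauchy_kernel t.
Proof.
  intros Ht.
  assert (Hqt : t < t / q).
  { apply Rmult_lt_reg_r with q; [lra|]. unfold Rdiv.
    rewrite Rmult_assoc, Rinv_l; nra. }
  destruct (MVT_cor2 atan (fun t => / (1 + t ^ 2)) t (t / q) Hqt) as (c & E & Hc).
  { intros c _. apply derivable_pt_lim_atan. }
  rewrite E. clear E.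
  assert (Hd : t / q - t = (1 - q) / q * t) by (field; lra).
  rewrite Hd. unfold cauchy_kernel.
  assert (Hcq : c * q < t).
  { replace t with (t / q * q) by (field; lra). apply Rmult_lt_compat_r; lra. }
  assert (Hk : 0 < (1 - q) / q) by (apply Rdiv_lt_0_compat; lra).
  split.
  - replace (q * (1 - q) * (t / (1 + t * t)))
      with (/ ((1 + t * t) / (q * q)) * ((1 - q) / q * t)) by (field; nra).
    apply Rmult_le_compat_r; [nra|].
    apply Rinv_le_contravar; [nra|].
    apply Rmult_le_reg_r with (q * q); [nra|].
    replace ((1 + t * t) / (q * q) * (q * q)) with (1 + t * t) by (field; lra).
    assert (0 <= c * q) by nra. nra.
  - replace ((1 - q) / q * (t / (1 + t * t)))
      with (/ (1 + t * t) * ((1 - q) / q * t)) by (field; nra).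
    apply Rmult_le_compat_r; [nra|].
    apply Rinv_le_contravar; nra.
Qed.

Lemma qsum_atan_telescope (N : nat) (x : R) :
  psum (fun j => atan (b j * x / q) - atan (b j * x)) N
    = atan ((1 - q) * x / q) - atan (b N * x / q).
Proof.
  rewrite (psum_ext _ (fun j => atan (b j * x / q) - atan (b (S j) * x / q))).
  - rewrite (psum_telescope (fun j => atan (b j * x / q))).
    unfold qb. simpl. now rewrite Rmult_1_r.
  - intros j _. rewrite qb_S. do 2 f_equal. field. lra.
Qed.

Lemma qsum_kernel_lower (N : nat) (x : R) : 0 < x ->
  q / (1 - q) * (atan ((1 - q) * x / q) - atan (b N * x / q))
    <= qsum q cauchy_kernel N x.
Proof.
  intros Hx. rewrite <- qsum_atan_telescope, <- psum_scal.
  apply psum_le. intros j _.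
  destruct (atan_kernel_bounds (b j * x)) as [_ H].
  { apply Rmult_lt_0_compat; [apply b_pos|exact Hx]. }
  replace (cauchy_kernel (b j * x))
    with (q / (1 - q) * ((1 - q) / q * cauchy_kernel (b j * x))) by (field; lra).
  apply Rmult_le_compat_l; [|exact H].
  apply Rlt_le, Rdiv_lt_0_compat; lra.
Qed.

(** The whole telescoped increment of [atan] is at most [PI / 2], divided by the lower constant of
    [atan_kernel_bounds]. *)
Definition kernel_sup : R := PI / 2 / (q * (1 - q)).

Lemma qsum_kernel_upper (N : nat) (x : R) : 0 < x ->
  qsum q cauchy_kernel N x <= kernel_sup.
Proof.
  intros Hx. assert (Hqq : 0 < q * (1 - q)) by nra.
  apply Rmult_le_reg_l with (q * (1 - q)); [exact Hqq|].
  replace (q * (1 - q) * kernel_sup) with (PI / 2) by (unfold kernel_sup; field; lra).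
  unfold qsum. rewrite <- psum_scal.
  eapply Rle_trans; [apply psum_le|].
  - intros j _. apply (atan_kernel_bounds (b j * x)).
    apply Rmult_lt_0_compat; [apply b_pos|exact Hx].
  - rewrite qsum_atan_telescope.
    pose proof (atan_bound ((1 - q) * x / q)).
    assert (0 <= atan (b N * x / q)); [|lra].
    apply atan_nonneg. pose proof (b_pos N).
    apply Rle_mult_inv_pos; [nra|lra].
Qed.

Lemma qsum_le_qseries (g : R -> R) (N : nat) (x : R) :
  tame g -> (forall t, 0 <= t -> 0 <= g t) -> 0 <= x ->
  qsum q g N x <= qseries q g x.
Proof.
  intros Hg Hpos Hx. apply (psum_le_Series (fun j => g (b j * x))).
  - intros j. apply Hpos. pose proof (b_pos j). nra.
  - now apply ex_qseries.
Qed.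

Lemma qsum_lim_const (g : R -> R) (x : R) : tame g ->
  is_lim_seq (fun N => qsum q g N x) (qseries q g x).
Proof.
  intros Hg. apply (qsum_lim q Hq g (fun n => n) (fun _ => x)); auto.
  apply is_lim_seq_const.
Qed.

Lemma qb_lim (x : R) : is_lim_seq (fun N => b N * x) 0.
Proof.
  replace (Finite 0) with (Finite ((1 - q) * 0 * x)) by (f_equal; ring).
  apply (is_lim_seq_scal_r _ x ((1 - q) * 0)).
  apply (is_lim_seq_scal_l _ (1 - q) 0).
  apply is_lim_seq_geom. rewrite Rabs_pos_eq; lra.
Qed.

Lemma qseries_kernel_lower (x : R) : 0 < x ->
  q / (1 - q) * atan ((1 - q) * x / q) <= qseries q cauchy_kernel x.
Proof.
  intros Hx.
  apply (is_lim_seq_le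
    (fun N => q / (1 - q) * (atan ((1 - q) * x / q) - atan (b N * x / q)))
    (fun N => qsum q cauchy_kernel N x)
    (q / (1 - q) * atan ((1 - q) * x / q)) (qseries q cauchy_kernel x)).
  - intros N. now apply qsum_kernel_lower.
  - rewrite <- (Rminus_0_r (atan ((1 - q) * x / q))) at 1. rewrite <- atan_0.
    apply (is_lim_seq_scal_l _ (q / (1 - q)) (atan ((1 - q) * x / q) - atan 0)).
    apply is_lim_seq_minus'; [apply is_lim_seq_const|].
    apply (is_lim_seq_continuous atan (fun N => b N * x / q) 0);
      [apply (proj1 tame_atan)|].
    replace (Finite 0) with (Finite (0 * / q)) by (f_equal; ring).
    apply (is_lim_seq_scal_r (fun N => b N * x) (/ q) 0), qb_lim.
  - apply qsum_lim_const, tame_cauchy_kernel.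
Qed.

(** The Lipschitz constant is the sum of all [b j], which is 1. *)
Lemma phase_lipschitz (x y : R) : x <= y -> 0 <= phase q y - phase q x <= y - x.
Proof.
  intros H. unfold phase, qseries.
  assert (Ex := ex_qseries q Hq atan x tame_atan).
  assert (Ey := ex_qseries q Hq atan y tame_atan).
  rewrite <- (Series_minus _ _ Ey Ex).
  assert (Hd : forall j, 0 <= atan (b j * y) - atan (b j * x) <= b j * (y - x)).
  { intros j. pose proof (b_pos j). rewrite Rmult_minus_distr_l.
    apply atan_lipschitz. nra. }
  split.
  - apply (psum_le_Series _ 0); [intros; apply Hd|apply (ex_series_minus _ _ Ey Ex)].
  - replace (y - x) with (Series (fun j => b j * (y - x))).
    + apply Series_le; [exact Hd|apply (ex_qb_scal q Hq)].
    + rewrite Series_scal_r, (is_series_unique _ _ (qb_series q Hq)). ring.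
Qed.

Lemma phase_increasing (x y : R) : x < y -> phase q x < phase q y.
Proof.
  intros H. unfold phase, qseries.
  assert (Ex := ex_qseries q Hq atan x tame_atan).
  assert (Ey := ex_qseries q Hq atan y tame_atan).
  assert (0 < Series (fun j => atan (b j * y) - atan (b j * x))).
  2: { rewrite (Series_minus _ _ Ey Ex) in H0. lra. }
  assert (Hd : forall j, 0 < atan (b j * y) - atan (b j * x)).
  { intros j. apply Rlt_0_minus, atan_increasing, Rmult_lt_compat_l; [apply b_pos|exact H]. }
  eapply Rlt_le_trans; [|apply (psum_le_Series _ 1)].
  - simpl. specialize (Hd O). lra.
  - intros j. apply Rlt_le, Hd.
  - apply (ex_series_minus _ _ Ey Ex).
Qed.

Lemma phase_0 : phase q 0 = 0.
Proof.
  pose proof (phase_opp q 0) as H. rewrite Ropp_0 in H. lra.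
Qed.

(** Dividing [x] by [q] shifts the grid by one place and so adds a single argument, less than
    [PI / 2]. This is what separates consecutive zeros by a factor [/ q]. *)
Lemma phase_div_q (x : R) : phase q (x / q) = atan ((1 - q) * x / q) + phase q x.
Proof.
  unfold phase, qseries.
  rewrite Series_incr_1 by (apply ex_qseries, tame_atan; exact Hq).
  f_equal.
  - f_equal. unfold qb. simpl. field. lra.
  - apply Series_ext. intros j. rewrite qb_S. f_equal. field. lra.
Qed.

Lemma qsum_atan_lipschitz (N : nat) (x y : R) :
  x <= y -> 0 <= qsum q atan N y - qsum q atan N x <= INR N * (y - x).
Proof.
  intros H. unfold qsum. rewrite <- psum_minus, <- psum_const.
  assert (Hd : forall j, 0 <= atan (b j * y) - atan (b j * x) <= y - x).
  { intros j. pose proof (b_pos j).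
    assert (b j <= 1).
    { unfold qb. assert (q ^ j <= 1); [|assert (0 < q ^ j) by (apply pow_lt; lra); nra].
      rewrite <- (pow1 j). apply pow_incr. lra. }
    pose proof (atan_lipschitz (b j * x) (b j * y) ltac:(nra)). nra. }
  split.
  - rewrite <- (Rmult_0_r (INR N)), <- psum_const. apply psum_le. intros; apply Hd.
  - apply psum_le. intros; apply Hd.
Qed.

Lemma qsum_atan_le_phase (N : nat) (x : R) : 0 <= x -> qsum q atan N x <= phase q x.
Proof.
  intros Hx. apply qsum_le_qseries; auto using tame_atan, atan_nonneg.
Qed.

Lemma qsum_atan_0 (N : nat) : qsum q atan N 0 = 0.
Proof.
  unfold qsum. rewrite (psum_ext _ (fun _ => 0)); [rewrite psum_const; ring|].
  intros j _. now rewrite Rmult_0_r, atan_0.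
Qed.

(** Measures how far the truncated phase is below its supremum; the defect is then controlled by a
    geometric sum of inverses. *)
Lemma qsum_atan_complement (N : nat) (x : R) : 0 < x ->
  qsum q atan N x = INR N * (PI / 2) - psum (fun j => atan (/ (b j * x))) N.
Proof.
  intros Hx. unfold qsum. rewrite <- psum_const, <- psum_minus.
  apply psum_ext. intros j _. rewrite atan_inv.
  - ring.
  - apply Rmult_lt_0_compat; [apply b_pos|exact Hx].
Qed.

Lemma psum_inv_qb (N : nat) (x : R) : 0 < x ->
  psum (fun j => / (b j * x)) N <= q / ((1 - q) * (b N * x)).
Proof.
  intros Hx. pose proof (b_pos N) as HbN.
  induction N as [|N IH].
  - simpl. apply Rlt_le, Rdiv_lt_0_compat; [lra|]. apply Rmult_lt_0_compat; nra.
  - cbn [psum]. pose proof (b_pos N) as Hb. rewrite qb_S in *.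
    specialize (IH Hb).
    eapply Rle_trans; [apply Rplus_le_compat_r, IH|].
    (* The bound reproduces itself: q / (1 - q) + 1 = 1 / (1 - q), and the next grid point is [q]
       times the previous one. *)
    right. field. repeat split; lra.
Qed.

Lemma psum_atan_inv_le (N : nat) (x : R) : 0 < x ->
  psum (fun j => atan (/ (b j * x))) N <= q / ((1 - q) * (b N * x)).
Proof.
  intros Hx. eapply Rle_trans; [apply psum_le|apply psum_inv_qb, Hx].
  intros j _.
  assert (H : 0 <= / (b j * x)).
  { apply Rlt_le, Rinv_0_lt_compat, Rmult_lt_0_compat; [apply b_pos|exact Hx]. }
  pose proof (atan_lipschitz 0 _ H) as H1. rewrite atan_0 in H1. lra.
Qed.

Lemma qsum_atan_large (N : nat) (a : R) :
  a < INR N * (PI / 2) -> exists X, 0 < X /\ a < qsum q atan N X.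
Proof.
  intros Ha. set (e := INR N * (PI / 2) - a).
  assert (He : 0 < e) by (unfold e; lra).
  pose proof (b_pos N) as Hb.
  (* Chosen so that the bound on the defect equals [e / 2]. *)
  set (X := 2 * q / ((1 - q) * b N * e)).
  assert (Hden : 0 < (1 - q) * b N * e) by (apply Rmult_lt_0_compat; nra).
  assert (HX : 0 < X) by (apply Rdiv_lt_0_compat; lra).
  exists X. split; [exact HX|].
  rewrite qsum_atan_complement by exact HX.
  pose proof (psum_atan_inv_le N X HX) as H.
  replace (q / ((1 - q) * (b N * X))) with (e / 2) in H.
  - unfold e in *. lra.
  - unfold X. field. repeat split; lra.
Qed.

Lemma phase_large (a : R) : exists X, 0 < X /\ a < phase q X.
Proof.
  destruct (INR_unbounded (a / (PI / 2))) as [N HN].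
  assert (HP := PI_RGT_0).
  destruct (qsum_atan_large N a) as (X & HX & H).
  - replace a with (a / (PI / 2) * (PI / 2)) by (field; lra).
    apply Rmult_lt_compat_r; lra.
  - exists X. split; [exact HX|].
    eapply Rlt_le_trans; [exact H|apply qsum_atan_le_phase; lra].
Qed.

Lemma lipschitz_ivt (f : R -> R) (K a X : R) :
  (forall x y, x <= y -> 0 <= f y - f x <= K * (y - x)) ->
  0 < X -> f 0 < a < f X -> exists r, 0 < r /\ f r = a.
Proof.
  intros Hf HX Ha.
  assert (Hc : continuity f).
  { intros x eps Heps. exists (eps / (Rabs K + 1)).
    pose proof (Rabs_pos K) as HK. pose proof (Rle_abs K) as HK'.
    split; [apply Rdiv_lt_0_compat; lra|].
    intros y [_ Hy]. unfold Rdist in *. simpl in *. unfold Rdist in *.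
    apply Rle_lt_trans with ((Rabs K + 1) * Rabs (y - x)).
    - destruct (Rle_dec x y) as [H|H].
      + pose proof (Hf x y H). rewrite (Rabs_pos_eq (f y - f x)),
          (Rabs_pos_eq (y - x)); try lra. nra.
      + pose proof (Hf y x ltac:(lra)). rewrite (Rabs_left1 (f y - f x)),
          (Rabs_left1 (y - x)); try lra. nra.
    - apply (Rmult_lt_compat_l (Rabs K + 1)) in Hy; [|lra].
      replace ((Rabs K + 1) * (eps / (Rabs K + 1))) with eps in Hy by (field; lra).
      exact Hy. }
  destruct (IVT_cor (fun x => f x - a) 0 X) as (r & Hr & E).
  - apply continuity_minus; [exact Hc|apply continuity_const; intros u v; reflexivity].
  - lra.
  - nra.
  - exists r. split; [|lra]. destruct Hr as [[Hr| <-] _]; [exact Hr|]. lra.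
Qed.

Lemma phase_onto (a : R) : 0 < a -> exists r, 0 < r /\ phase q r = a.
Proof.
  intros Ha. destruct (phase_large a) as (X & HX & H).
  apply (lipschitz_ivt (phase q) 1 a X); [|exact HX|rewrite phase_0; lra].
  intros x y Hxy. rewrite Rmult_1_l. now apply phase_lipschitz.
Qed.

Lemma qsum_atan_onto (N : nat) (a : R) :
  0 < a < INR N * (PI / 2) -> exists r, 0 < r /\ qsum q atan N r = a.
Proof.
  intros Ha. destruct (qsum_atan_large N a) as (X & HX & H); [lra|].
  apply (lipschitz_ivt (qsum q atan N) (INR N) a X);
    [apply qsum_atan_lipschitz|exact HX|rewrite qsum_atan_0; lra].
Qed.

(* The gap below the supremum [N * PI / 2] of the truncated phase keeps
   [b (N - 1) * x] bounded, so the telescoping bound cannot degenerate. *)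
Lemma qsum_kernel_lower_gap (x1 : R) : 0 < x1 ->
  exists c, 0 < c /\ forall N x, x1 <= x ->
    qsum q atan N x <= INR N * (PI / 2) - PI / 2 ->
    c <= qsum q cauchy_kernel N x.
Proof.
  intros Hx1. set (d := (1 - q) * x1). set (T := / (1 - q)).
  assert (Hd : 0 < d) by (unfold d; nra).
  assert (HT : 0 < T) by (apply Rinv_0_lt_compat; lra).
  assert (Hdq : d < d / q).
  { apply Rmult_lt_reg_r with q; [lra|]. unfold Rdiv.
    rewrite Rmult_assoc, Rinv_l; nra. }
  (* Two regimes for the last grid point [t]. If [t <= d], the telescoped increment reaches from [d]
     to [d / q] at least, which gives [c1]; if [d < t <= T], the last summand alone is at least
     [c2]. *)
  set (c1 := q / (1 - q) * (atan (d / q) - atan d)).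
  set (c2 := d / (1 + T * T)).
  assert (Hc1 : 0 < c1).
  { apply Rmult_lt_0_compat; [apply Rdiv_lt_0_compat; lra|].
    apply Rlt_0_minus, atan_increasing, Hdq. }
  assert (Hc2 : 0 < c2) by (apply Rdiv_lt_0_compat; nra).
  exists (Rmin c1 c2). split; [now apply Rmin_glb_lt|].
  intros N x Hx Hgap. assert (HP := PI_RGT_0).
  rewrite qsum_atan_complement in Hgap by lra.
  pose proof (psum_atan_inv_le N x ltac:(lra)) as Hinv.
  destruct N as [|N]; [simpl in Hgap; lra|].
  rewrite qb_S in Hinv. pose proof (b_pos N) as Hb.
  set (t := b N * x) in *. assert (Ht : 0 < t) by (apply Rmult_lt_0_compat; lra).
  (* The gap makes the defect at least [PI / 2], hence at least 1, while the geometric sum bounds it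
     by [T / t]. *)
  assert (HtT : t <= T).
  { replace (q / ((1 - q) * (q * b N * x))) with (T / t) in Hinv
      by (unfold T, t; field; repeat split; lra).
    assert (H : 1 <= T / t) by (pose proof PI2_1; lra).
    apply (Rmult_le_compat_r t) in H; [|lra].
    replace (T / t * t) with T in H by (field; lra). lra. }
  destruct (Rle_dec t d) as [H|H].
  - eapply Rle_trans; [apply Rmin_l|].
    eapply Rle_trans; [|apply qsum_kernel_lower; lra].
    apply Rmult_le_compat_l; [apply Rlt_le, Rdiv_lt_0_compat; lra|].
    replace (b (S N) * x / q) with t by (rewrite qb_S; unfold t; field; lra).
    assert (atan (d / q) <= atan ((1 - q) * x / q)).
    { destruct (Req_dec x x1) as [->|Hne]; [unfold d; lra|].
      apply Rlt_le, atan_increasing. unfold d, Rdiv.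
      apply Rmult_lt_compat_r; [apply Rinv_0_lt_compat; lra|nra]. }
    assert (atan t <= atan d).
    { destruct (Req_dec t d) as [->|Hne]; [lra|]. apply Rlt_le, atan_increasing. lra. }
    lra.
  - eapply Rle_trans; [apply Rmin_r|]. rewrite qsum_S. fold t.
    assert (0 <= qsum q cauchy_kernel N x).
    { apply (psum_incr (fun j => cauchy_kernel (b j * x)) 0 N); [|lia].
      intros j. apply cauchy_kernel_nonneg. pose proof (b_pos j). nra. }
    assert (c2 <= cauchy_kernel t); [|lra].
    unfold c2, cauchy_kernel, Rdiv.
    apply Rmult_le_compat; try lra.
    + apply Rlt_le, Rinv_0_lt_compat. nra.
    + apply Rinv_le_contravar; nra.
Qed.

(** The first [L] factors satisfy sqrt (1 + (b_j x)^2) >= b_j x and the others are at least 1. As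
    [K] does not depend on [N], the bound serves the truncations and the limit alike. *)
Lemma modulus_poly_lower (L : nat) :
  exists K, 0 < K /\ forall N x, (L <= N)%nat -> 0 < x ->
    K * x ^ L <= exp (qsum q half_ln N x).
Proof.
  assert (Hmono : forall N M x, (M <= N)%nat ->
            exp (qsum q half_ln M x) <= exp (qsum q half_ln N x)).
  { intros N M x H.
    assert (Hle : qsum q half_ln M x <= qsum q half_ln N x).
    { apply psum_incr; [|exact H]. intros; apply half_ln_nonneg. }
    destruct Hle as [Hle| ->]; [apply Rlt_le, exp_increasing, Hle|lra]. }
  induction L as [|L (K & HK & IH)].
  - exists 1. split; [lra|]. intros N x HN Hx.
    eapply Rle_trans; [|apply (Hmono N 0%nat); lia].
    unfold qsum. simpl. rewrite exp_0. lra.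
  - exists (K * b L). pose proof (b_pos L) as Hb. split; [nra|].
    intros N x HN Hx. eapply Rle_trans; [|apply (Hmono N (S L)); lia].
    rewrite qsum_S, exp_plus, exp_half_ln.
    specialize (IH L x (Nat.le_refl L) Hx).
    replace (K * b L * x ^ S L) with (K * x ^ L * (b L * x)) by (simpl; ring).
    assert (0 < x ^ L) by (apply pow_lt; lra).
    apply Rmult_le_compat; try nra.
    rewrite <- (sqrt_Rsqr (b L * x)) at 1 by nra.
    apply sqrt_le_1_alt. unfold Rsqr. lra.
Qed.

Lemma modulus_ge_qsum (N : nat) (x : R) :
  0 <= x -> exp (qsum q half_ln N x) <= modulus q x.
Proof.
  intros Hx. unfold modulus.
  assert (H : qsum q half_ln N x <= qseries q half_ln x)
    by (apply qsum_le_qseries; auto using tame_half_ln, half_ln_nonneg).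
  destruct H as [H| ->]; [apply Rlt_le, exp_increasing, H|lra].
Qed.

End Bounds.

(** * Power series of Sin_q and Cos_q *)

Lemma ex_series_bounded (f : nat -> R) (C : R) :
  (forall k, 0 <= f k) -> (forall n, psum f n <= C) -> ex_series f.
Proof.
  intros Hf HC.
  destruct (ex_finite_lim_seq_incr (psum f) C) as [l Hl]; [|exact HC|].
  - intros n. simpl. specialize (Hf n). lra.
  - exists l. now apply psum_lim.
Qed.

(* The coefficient of [z ^ k] in [E_q z], that is q^(k(k-1)/2) / [k]!. *)
Fixpoint Eq_coef (q : R) (k : nat) : R :=
  match k with
  | O => 1
  | S m => Eq_coef q m * (q ^ m / qnum q (S m))
  end.

Definition Cos_coef (q : R) (j : nat) : R := (-1) ^ j * Eq_coef q (2 * j).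
Definition Sin_coef (q : R) (j : nat) : R := (-1) ^ j * Eq_coef q (2 * j + 1).

Section PowerSeries.

Context (q : R) (Hq : 0 < q < 1).

Notation b := (qb q).
Notation ec := (Eq_coef q).

Lemma pow_q_lt_1 (n : nat) : 0 < q ^ S n < 1.
Proof.
  split; [apply pow_lt; lra|]. apply pow_lt_1_compat; [lra|lia].
Qed.

Lemma qnum_ge_1 (n : nat) : 1 <= qnum q (S n).
Proof.
  unfold qnum. apply Rmult_le_reg_r with (1 - q); [lra|].
  replace ((1 - q ^ S n) / (1 - q) * (1 - q)) with (1 - q ^ S n) by (field; lra).
  simpl. assert (q ^ n <= 1); [|nra].
  rewrite <- (pow1 n). apply pow_incr. lra.
Qed.

Lemma Eq_coef_pos (k : nat) : 0 < ec k.
Proof.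
  induction k as [|k IH]; simpl; [lra|].
  apply Rmult_lt_0_compat; [exact IH|].
  pose proof (qnum_ge_1 k). apply Rdiv_lt_0_compat; [apply pow_lt; lra|lra].
Qed.

(** The functional equation E(x) = (1 + (1 - q) x) E(q x), read on coefficients. *)
Lemma Eq_coef_rec (k : nat) : ec (S k) * (1 - q ^ S k) = (1 - q) * q ^ k * ec k.
Proof.
  cbn [Eq_coef]. unfold qnum. pose proof (pow_q_lt_1 k). field. lra.
Qed.

Lemma Eq_coef_closed (j : nat) :
  ec (2 * j) = q ^ (j * (2 * j - 1)) / qfact q (2 * j) /\
  ec (2 * j + 1) = q ^ (j * (2 * j + 1)) / qfact q (2 * j + 1).
Proof.
  assert (Hn : forall n, qnum q (S n) <> 0) by (intros n; pose proof (qnum_ge_1 n); lra).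
  assert (Hf : forall n, qfact q n <> 0).
  { induction n as [|n IH]; simpl; [lra|]. now apply Rmult_integral_contrapositive_currified. }
  assert (Hodd : forall j, ec (2 * j) = q ^ (j * (2 * j - 1)) / qfact q (2 * j) ->
    ec (2 * j + 1) = q ^ (j * (2 * j + 1)) / qfact q (2 * j + 1)).
  { intros k E. rewrite Nat.add_1_r. cbn [Eq_coef qfact]. rewrite E.
    replace (k * (S (2 * k)))%nat with (k * (2 * k - 1) + 2 * k)%nat by nia.
    rewrite pow_add.  field. auto. }
  assert (Heven : ec (2 * j) = q ^ (j * (2 * j - 1)) / qfact q (2 * j)).
  { induction j as [|j IH]; [simpl; field|].
    apply Hodd in IH.
    replace (2 * S j)%nat with (S (2 * j + 1)) by lia.
    cbn [Eq_coef qfact]. rewrite IH.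
    replace (S j * (S (2 * j + 1) - 1))%nat with (j * (2 * j + 1) + (2 * j + 1))%nat by nia.
    rewrite (pow_add q (j * (2 * j + 1))). field. auto. }
  auto.
Qed.

Lemma ex_Eq_series (x : R) : 0 <= x -> ex_series (fun k => ec k * x ^ k).
Proof.
  intros Hx.
  assert (Hr : CV_radius ec = p_infty).
  { apply CV_radius_infinite_DAlembert.
    - intros n. pose proof (Eq_coef_pos n). lra.
    - apply is_lim_seq_le_le with (fun _ => 0) (fun n => q ^ n).
      + intros n. split; [apply Rabs_pos|].
        pose proof (Eq_coef_pos n). pose proof (qnum_ge_1 n).
        assert (0 < q ^ n) by (apply pow_lt; lra).
        cbn [Eq_coef].
        replace (ec n * (q ^ n / qnum q (S n)) / ec n) with (q ^ n * / qnum q (S n))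
          by (field; lra).
        assert (0 < / qnum q (S n)) by (apply Rinv_0_lt_compat; lra).
        rewrite Rabs_pos_eq by nra.
        rewrite <- (Rmult_1_r (q ^ n)) at 2.
        apply Rmult_le_compat_l; [lra|].
        rewrite <- Rinv_1. apply Rinv_le_contravar; lra.
      + apply is_lim_seq_const.
      + apply is_lim_seq_geom. rewrite Rabs_pos_eq; lra. }
  apply (ex_series_ext (fun k => Rabs (ec k * x ^ k))).
  - intros k. apply Rabs_pos_eq. pose proof (Eq_coef_pos k).
    assert (0 <= x ^ k) by (now apply pow_le). nra.
  - apply CV_disk_inside. rewrite Hr. exact I.
Qed.

Definition Eq_real (x : R) : R := Series (fun k => ec k * x ^ k).

Lemma Eq_term_nonneg (x : R) (k : nat) : 0 <= x -> 0 <= ec k * x ^ k.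
Proof.
  intros Hx. pose proof (Eq_coef_pos k).
  assert (0 <= x ^ k) by (now apply pow_le). nra.
Qed.

(** Up to sign these are the even-indexed terms of the positive series for E_q(x), all found among
    its first [2 * n] terms. [Sin_majorant] uses the odd-indexed ones, so both share a majorant
    comparable to the modulus. *)
Lemma Cos_majorant (x : R) (n : nat) : 0 <= x ->
  psum (fun j => Rabs (Cos_coef q j * x ^ (2 * j))) n <= Eq_real x.
Proof.
  intros Hx.
  eapply Rle_trans; [|apply (psum_le_Series _ (2 * n));
    [intros; now apply Eq_term_nonneg|now apply ex_Eq_series]].
  induction n as [|n IH]; [simpl; lra|].
  replace (2 * S n)%nat with (S (S (2 * n))) by lia. cbn [psum].
  pose proof (Eq_term_nonneg x (S (2 * n)) Hx).
  unfold Cos_coef at 2. rewrite Rmult_assoc, Rabs_mult, pow_1_abs, Rmult_1_l.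
  rewrite Rabs_pos_eq by now apply Eq_term_nonneg. lra.
Qed.

Lemma Sin_majorant (x : R) (n : nat) : 0 <= x ->
  psum (fun j => Rabs (Sin_coef q j * x ^ (2 * j + 1))) n <= Eq_real x.
Proof.
  intros Hx.
  eapply Rle_trans; [|apply (psum_le_Series _ (2 * n));
    [intros; now apply Eq_term_nonneg|now apply ex_Eq_series]].
  induction n as [|n IH]; [simpl; lra|].
  replace (2 * S n)%nat with (S (S (2 * n))) by lia. cbn [psum].
  pose proof (Eq_term_nonneg x (2 * n) Hx).
  unfold Sin_coef at 2. rewrite Rmult_assoc, Rabs_mult, pow_1_abs, Rmult_1_l.
  rewrite Rabs_pos_eq by now apply Eq_term_nonneg.
  rewrite Nat.add_1_r. lra.
Qed.

Lemma ex_Cos_series_abs (x : R) : 0 <= x ->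
  ex_series (fun j => Rabs (Cos_coef q j * x ^ (2 * j))).
Proof.
  intros Hx. apply (ex_series_bounded _ (Eq_real x)).
  - intros; apply Rabs_pos.
  - intros; now apply Cos_majorant.
Qed.

Lemma ex_Sin_series_abs (x : R) : 0 <= x ->
  ex_series (fun j => Rabs (Sin_coef q j * x ^ (2 * j + 1))).
Proof.
  intros Hx. apply (ex_series_bounded _ (Eq_real x)).
  - intros; apply Rabs_pos.
  - intros; now apply Sin_majorant.
Qed.

Lemma geom_scal_lim (x : R) : is_lim_seq (fun N => q ^ N * x) 0.
Proof.
  replace (Finite 0) with (Finite (0 * x)) by (f_equal; ring).
  apply (is_lim_seq_scal_r _ x 0).
  apply is_lim_seq_geom. rewrite Rabs_pos_eq; lra.
Qed.

(** Continuity at 0 along [q ^ N * x], dominated by the series at [x]. As [0 ^ 0 = 1], the limit is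
    the constant term for [Cos_coef] and 0 for [Sin_coef]. *)
Lemma power_series_lim_0 (c : nat -> R) (p : nat -> nat) (x : R) :
  0 <= x -> (forall j, p (S j) <> O) ->
  ex_series (fun j => Rabs (c j * x ^ p j)) ->
  is_lim_seq (fun N => Series (fun j => c j * (q ^ N * x) ^ p j)) (c O * 0 ^ p O).
Proof.
  intros Hx Hp Hex.
  replace (c O * 0 ^ p O) with (Series (fun j => c j * 0 ^ p j)).
  - apply (tannery _ _ (fun j => Rabs (c j * x ^ p j)) 0); [exact Hex| |].
    + intros N j _. rewrite !Rabs_mult. apply Rmult_le_compat_l; [apply Rabs_pos|].
      assert (0 < q ^ N) by (apply pow_lt; lra).
      rewrite !Rabs_pos_eq by (apply pow_le; nra).
      apply pow_incr. split; [nra|].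
      assert (q ^ N <= 1) by (rewrite <- (pow1 N); apply pow_incr; lra). nra.
    + intros j.
      apply (is_lim_seq_continuous (fun y => c j * y ^ p j) _ 0); [|apply geom_scal_lim].
      apply continuity_pt_filterlim, (ex_derive_continuous (fun y => c j * y ^ p j)).
      auto_derive. exact I.
  - apply is_series_unique, psum_lim.
    apply is_lim_seq_ext_loc with (fun _ => c O * 0 ^ p O); [|apply is_lim_seq_const].
    exists 1%nat. intros n Hn. induction Hn as [|n Hn IH]; [simpl; ring|].
    cbn [psum]. rewrite <- IH. destruct n as [|n]; [lia|].
    rewrite (pow_i (p (S n))) by (specialize (Hp n); lia). ring.
Qed.

Definition Cos_real (x : R) : R := Series (fun j => Cos_coef q j * x ^ (2 * j)).
Definition Sin_real (x : R) : R := Series (fun j => Sin_coef q j * x ^ (2 * j + 1)).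

(** Real part of E(ix) = (1 + i (1 - q) x) E(i q x); [Sin_real_step] is the imaginary part. *)
Lemma Cos_real_step (x : R) : 0 <= x ->
  Cos_real x = Cos_real (q * x) - (1 - q) * x * Sin_real (q * x).
Proof.
  intros Hx. unfold Cos_real, Sin_real.
  assert (Hqx : 0 <= q * x) by nra.
  assert (E1 := ex_series_Rabs _ (ex_Cos_series_abs x Hx)).
  assert (E2 := ex_series_Rabs _ (ex_Cos_series_abs (q * x) Hqx)).
  assert (E3 := ex_series_Rabs _ (ex_Sin_series_abs (q * x) Hqx)).
  rewrite (Series_incr_1 _ E1), (Series_incr_1 _ E2).
  simpl (x ^ (2 * 0)). simpl ((q * x) ^ (2 * 0)).
  enough (Series (fun j => Cos_coef q (S j) * x ^ (2 * S j)) =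
    Series (fun j => Cos_coef q (S j) * (q * x) ^ (2 * S j)) -
    (1 - q) * x * Series (fun j => Sin_coef q j * (q * x) ^ (2 * j + 1))) by lra.
  rewrite <- Series_scal_l, <- Series_minus.
  - apply Series_ext. intros j. unfold Cos_coef, Sin_coef.
    replace (2 * S j)%nat with (S (2 * j + 1)) by lia.
    rewrite !Rpow_mult_distr. pose proof (Eq_coef_rec (2 * j + 1)) as H.
    cbn [pow] in *. set (e := ec (S (2 * j + 1))) in *. set (e' := ec (2 * j + 1)) in *.
    set (Q := q ^ (2 * j + 1)) in *. set (Z := x ^ (2 * j + 1)).
    replace e with (e * (1 - q * Q) + e * (q * Q)) at 1 by ring. rewrite H. ring.
  - now apply (ex_series_incr_1 (fun j => Cos_coef q j * (q * x) ^ (2 * j))).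
  - exact (ex_series_scal_l ((1 - q) * x) _ E3).
Qed.

Lemma Sin_real_step (x : R) : 0 <= x ->
  Sin_real x = Sin_real (q * x) + (1 - q) * x * Cos_real (q * x).
Proof.
  intros Hx. unfold Cos_real, Sin_real.
  assert (Hqx : 0 <= q * x) by nra.
  assert (E2 := ex_series_Rabs _ (ex_Cos_series_abs (q * x) Hqx)).
  assert (E3 := ex_series_Rabs _ (ex_Sin_series_abs (q * x) Hqx)).
  rewrite <- Series_scal_l, <- Series_plus; [|exact E3|].
  - apply Series_ext. intros j. unfold Cos_coef, Sin_coef.
    rewrite !Rpow_mult_distr, Nat.add_1_r. pose proof (Eq_coef_rec (2 * j)) as H.
    set (k := (2 * j)%nat) in *. cbn [pow] in *.
    set (e := ec (S k)) in *. set (e' := ec k) in *.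
    set (Q := q ^ k) in *. set (Z := x ^ k).
    replace e with (e * (1 - q * Q) + e * (q * Q)) at 1 by ring. rewrite H. ring.
  - exact (ex_series_scal_l ((1 - q) * x) _ E2).
Qed.

(** Real and imaginary parts of the truncated product at ix, in polar form. That they are
    polynomials in [x] is seen from the recurrences that follow. *)
Definition poly_re (N : nat) (x : R) : R :=
  exp (qsum q half_ln N x) * cos (qsum q atan N x).
Definition poly_im (N : nat) (x : R) : R :=
  exp (qsum q half_ln N x) * sin (qsum q atan N x).

Lemma poly_re_S (N : nat) (x : R) :
  poly_re (S N) x = poly_re N x - b N * x * poly_im N x.
Proof.
  unfold poly_re, poly_im. rewrite !qsum_S. set (t := b N * x).
  rewrite exp_plus, cos_plus, cos_atan, sin_atan, exp_half_ln. unfold Rsqr.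
  assert (0 < sqrt (1 + t * t)) by (apply sqrt_lt_R0; nra). field. lra.
Qed.

Lemma poly_im_S (N : nat) (x : R) :
  poly_im (S N) x = poly_im N x + b N * x * poly_re N x.
Proof.
  unfold poly_re, poly_im. rewrite !qsum_S. set (t := b N * x).
  rewrite exp_plus, sin_plus, cos_atan, sin_atan, exp_half_ln. unfold Rsqr.
  assert (0 < sqrt (1 + t * t)) by (apply sqrt_lt_R0; nra). field. lra.
Qed.

(** Real and imaginary parts of the [N]-fold functional equation: the truncated product times E(i
    q^N x). The latter tends to 1, which identifies the power series with the infinite product. *)
Lemma real_series_iter (x : R) (N : nat) : 0 <= x ->
  Cos_real x = poly_re N x * Cos_real (q ^ N * x) - poly_im N x * Sin_real (q ^ N * x) /\
  Sin_real x = poly_re N x * Sin_real (q ^ N * x) + poly_im N x * Cos_real (q ^ N * x).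
Proof.
  intros Hx. induction N as [|N [IC IS]].
  - unfold poly_re, poly_im, qsum. simpl. rewrite exp_0, cos_0, sin_0, !Rmult_1_l.
    split; ring.
  - assert (0 < q ^ N) by (apply pow_lt; lra).
    rewrite (Cos_real_step (q ^ N * x)) in IC, IS by nra.
    rewrite (Sin_real_step (q ^ N * x)) in IC, IS by nra.
    replace (q ^ S N * x) with (q * (q ^ N * x)) by (simpl; ring).
    rewrite poly_re_S, poly_im_S. rewrite IC at 1. rewrite IS. unfold qb.
    split; ring.
Qed.

Lemma poly_lim (x : R) :
  is_lim_seq (fun N => poly_re N x) (modulus q x * cos (phase q x)) /\
  is_lim_seq (fun N => poly_im N x) (modulus q x * sin (phase q x)).
Proof.
  assert (Hm : is_lim_seq (fun n => exp (qsum q half_ln n x)) (modulus q x)).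
  { apply (is_lim_seq_continuous exp _ (qseries q half_ln x));
      [apply derivable_continuous, derivable_exp|].
    apply (qsum_lim_const q Hq), tame_half_ln. }
  assert (Hp := qsum_lim_const q Hq atan x tame_atan).
  split; apply (is_lim_seq_mult' _ _ _ _ Hm).
  - apply (is_lim_seq_continuous cos _ (phase q x)); [apply continuity_cos|exact Hp].
  - apply (is_lim_seq_continuous sin _ (phase q x)); [apply continuity_sin|exact Hp].
Qed.

Lemma real_series_eq (x : R) : 0 <= x ->
  Cos_real x = modulus q x * cos (phase q x) /\
  Sin_real x = modulus q x * sin (phase q x).
Proof.
  intros Hx. destruct (poly_lim x) as [Hre Him].
  assert (HC : is_lim_seq (fun N => Cos_real (q ^ N * x)) 1).
  { replace 1 with (Cos_coef q 0 * 0 ^ (2 * 0))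
      by (unfold Cos_coef; simpl; ring).
    apply (power_series_lim_0 (Cos_coef q) (fun j => 2 * j)%nat x Hx).
    - intros; lia.
    - now apply ex_Cos_series_abs. }
  assert (HS : is_lim_seq (fun N => Sin_real (q ^ N * x)) 0).
  { replace 0 with (Sin_coef q 0 * 0 ^ (2 * 0 + 1)) by (simpl; ring).
    apply (power_series_lim_0 (Sin_coef q) (fun j => 2 * j + 1)%nat x Hx).
    - intros; lia.
    - now apply ex_Sin_series_abs. }
  assert (H : forall u l a, (forall N, u N = a) -> is_lim_seq u (Finite l) -> a = l).
  { intros u l a Hu Hl. apply is_lim_seq_unique in Hl.
    rewrite (Lim_seq_ext _ _ Hu), Lim_seq_const in Hl. congruence. }
  split.
  - replace (modulus q x * cos (phase q x))
      with (modulus q x * cos (phase q x) * 1 - modulus q x * sin (phase q x) * 0) by ring.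
    eapply H; [intros N; symmetry; apply (real_series_iter x N Hx)|].
    apply is_lim_seq_minus'; now apply is_lim_seq_mult'.
  - replace (modulus q x * sin (phase q x))
      with (modulus q x * cos (phase q x) * 0 + modulus q x * sin (phase q x) * 1) by ring.
    eapply H; [intros N; symmetry; apply (real_series_iter x N Hx)|].
    apply is_lim_seq_plus'; now apply is_lim_seq_mult'.
Qed.

Lemma Cos_q_series (x : R) : 0 <= x ->
  is_series (fun j => Cos_coef q j * x ^ (2 * j)) (modulus q x * cos (phase q x)).
Proof.
  intros Hx. rewrite <- (proj1 (real_series_eq x Hx)).
  apply Series_correct, ex_series_Rabs. now apply ex_Cos_series_abs.
Qed.

Lemma Sin_q_series (x : R) : 0 <= x ->
  is_series (fun j => Sin_coef q j * x ^ (2 * j + 1)) (modulus q x * sin (phase q x)).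
Proof.
  intros Hx. rewrite <- (proj2 (real_series_eq x Hx)).
  apply Series_correct, ex_series_Rabs. now apply ex_Sin_series_abs.
Qed.

Lemma Eq_real_step (x : R) : 0 <= x ->
  Eq_real x = (1 + (1 - q) * x) * Eq_real (q * x).
Proof.
  intros Hx. unfold Eq_real. assert (Hqx : 0 <= q * x) by nra.
  assert (E1 := ex_Eq_series x Hx). assert (E2 := ex_Eq_series (q * x) Hqx).
  rewrite Rmult_plus_distr_r, Rmult_1_l, <- Series_scal_l.
  rewrite (Series_incr_1 _ E1), (Series_incr_1 _ E2), Rplus_assoc.
  f_equal. rewrite <- Series_plus.
  - apply Series_ext. intros k. rewrite !Rpow_mult_distr.
    pose proof (Eq_coef_rec k) as H. cbn [pow] in *.
    replace (ec (S k)) with (ec (S k) * (1 - q * q ^ k) + ec (S k) * (q * q ^ k)) at 1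
      by ring.
    rewrite H. ring.
  - now apply (ex_series_incr_1 (fun k => ec k * (q * x) ^ k)).
  - exact (ex_series_scal_l ((1 - q) * x) _ E2).
Qed.

(* Comparing E_q(x) with |E_q(ix)|: the factors satisfy
   [1 + t <= sqrt (1 + t^2) * exp (t / (1 + t^2))]. *)
Lemma Eq_real_le_modulus (x : R) : 0 < x ->
  Eq_real x <= modulus q x * exp (kernel_sup q).
Proof.
  intros Hx.
  assert (Hnn : forall y, 0 <= y -> 0 <= Eq_real y).
  { intros y Hy. apply (psum_le_Series _ 0); [|now apply ex_Eq_series].
    intros; now apply Eq_term_nonneg. }
  assert (Hit : forall N, Eq_real x
    <= exp (qsum q half_ln N x + qsum q cauchy_kernel N x) * Eq_real (q ^ N * x)).
  { induction N as [|N IH].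
    - unfold qsum. simpl. rewrite Rplus_0_l, exp_0, !Rmult_1_l. lra.
    - eapply Rle_trans; [exact IH|]. rewrite !qsum_S.
      assert (Hy : 0 < q ^ N * x) by (apply Rmult_lt_0_compat; [apply pow_lt|]; lra).
      rewrite (Eq_real_step (q ^ N * x)) by lra.
      replace (q ^ S N * x) with (q * (q ^ N * x)) by (simpl; ring).
      replace (1 + (1 - q) * (q ^ N * x)) with (1 + b N * x) by (unfold qb; ring).
      set (t := b N * x).
      replace (qsum q half_ln N x + half_ln t + (qsum q cauchy_kernel N x + cauchy_kernel t))
        with (qsum q half_ln N x + qsum q cauchy_kernel N x + (half_ln t + cauchy_kernel t))
        by ring.
      rewrite (exp_plus _ (half_ln t + cauchy_kernel t)), Rmult_assoc.
      apply Rmult_le_compat_l; [apply Rlt_le, exp_pos|].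
      apply Rmult_le_compat_r; [apply Hnn; nra|].
      apply one_plus_le. unfold t. pose proof (qb_pos q Hq N). nra. }
  apply (is_lim_seq_le (fun _ => Eq_real x)
    (fun N => modulus q x * exp (kernel_sup q) * Eq_real (q ^ N * x))
    (Eq_real x) (modulus q x * exp (kernel_sup q))).
  - intros N. eapply Rle_trans; [apply (Hit N)|].
    assert (Hp : 0 < q ^ N) by (apply pow_lt; lra).
    apply Rmult_le_compat_r; [apply Hnn; nra|].
    rewrite exp_plus. apply Rmult_le_compat; try (apply Rlt_le, exp_pos).
    + apply modulus_ge_qsum; [exact Hq|lra].
    + destruct (qsum_kernel_upper q Hq N x Hx) as [H| ->];
        [apply Rlt_le, exp_increasing, H|lra].
  - apply is_lim_seq_const.
  - rewrite <- (Rmult_1_r (modulus q x * exp (kernel_sup q))) at 1.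
    apply (is_lim_seq_scal_l _ (modulus q x * exp (kernel_sup q)) 1).
    replace 1 with (ec 0 * 0 ^ 0) by (simpl; ring).
    apply (power_series_lim_0 ec (fun k => k) x); [lra|intros; lia|].
    apply (ex_series_ext (fun k => ec k * x ^ k)); [|apply ex_Eq_series; lra].
    intros k. symmetry. apply Rabs_pos_eq, Eq_term_nonneg. lra.
Qed.

End PowerSeries.

(** * Residue sums of real polynomials *)

Lemma is_derive_comp_sqr (f : R -> R) (x l : R) :
  is_derive f (x * x) l -> is_derive (fun y => f (y * y)) x (2 * x * l).
Proof.
  intros H. apply (is_derive_comp f (fun y => y * y) x l (2 * x) H).
  auto_derive; [exact I|ring].
Qed.

Lemma is_derive_mul_comp_sqr (f : R -> R) (x l : R) :
  is_derive f (x * x) l ->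
  is_derive (fun y => y * f (y * y)) x (f (x * x) + 2 * (x * x) * l).
Proof.
  intros H. apply is_derive_comp_sqr in H.
  replace (f (x * x) + 2 * (x * x) * l) with (1 * f (x * x) + x * (2 * x * l)) by ring.
  apply (is_derive_mult (fun y => y) (fun y => f (y * y)) x 1 (2 * x * l)
           (is_derive_id x) H).
  intros; apply Rmult_comm.
Qed.

(** Here [l] stands for p'(r^2): the derivative of p(x^2) at [r] is [2 * r * l], so a residue sum
    over positive zeros is half of one for p over their squares. *)
Lemma ratio_even (r l : R) (m : nat) :
  0 < r -> r ^ (2 * m + 1) / (2 * r * l) = / 2 * ((r * r) ^ m / l).
Proof.
  intros H. rewrite pow_add, pow_mult, pow_1. simpl (r ^ 2). rewrite Rmult_1_r.
  (* Abstracting [/ l] lets the identity hold for [l = 0] too, under the convention for division by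
     zero. *)
  unfold Rdiv. rewrite !Rinv_mult. set (L := / l). field. lra.
Qed.

Lemma ratio_odd (r l : R) (m : nat) :
  0 < r -> r ^ (2 * m + 2) / (2 * (r * r) * l) = / 2 * ((r * r) ^ m / l).
Proof.
  intros H. rewrite pow_add, pow_mult. simpl (r ^ 2). rewrite Rmult_1_r.
  unfold Rdiv. rewrite !Rinv_mult. set (L := / l). field. lra.
Qed.

Module PolynomialRoots.

Set Implicit Arguments.
Unset Strict Implicit.
Import all_boot all_algebra Rstruct ring.
Import GRing.Theory.
Local Open Scope ring_scope.

(** An algebraic form of the residue theorem. The Lagrange interpolant of ['X^m] at the roots is
    ['X^m] itself, and its coefficient in degree [(size rs).-1] is the sum times the leading
    coefficient of [p]; it vanishes because [m] is smaller than that degree. *)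
Lemma sum_pow_div_deriv (F : fieldType) (p : {poly F}) (rs : seq F) (m : nat) :
  uniq rs -> all (root p) rs -> size p = (size rs).+1 -> (m.+1 < size rs)%N ->
  \sum_(y <- rs) y ^+ m / p^`().[y] = 0.
Proof.
move=> rs_uniq rs_root sz_p lt_m.
have p0 : p != 0 by rewrite -size_poly_gt0 sz_p.
have l0 : lead_coef p != 0 by rewrite lead_coef_eq0.
have pE := all_roots_prod_XsubC sz_p rs_root (etrans (uniq_rootsE _) rs_uniq).
(* The quotient of [p] by ['X - y%:P]; its value at [y] is the derivative of [p] there. *)
pose g y := lead_coef p *: \prod_(z <- rs | z != y) ('X - z%:P).
have pgE y : y \in rs -> p = ('X - y%:P) * g y.
  by move=> yrs; rewrite {1}pE (bigD1_seq y) //= /g scalerAr.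
have sz_g y : y \in rs -> size (g y) = size rs.
  move=> yrs; have g0 : g y != 0.
    by apply: contraNneq p0 => gy0; rewrite (pgE y yrs) gy0 mulr0.
  have /eqP := sz_p; rewrite (pgE y yrs) size_monicM ?monicXsubC //.
  by rewrite size_XsubC addSn add1n /= eqSS => /eqP.
have lead_g y : y \in rs -> (g y)`_(size rs).-1 = lead_coef p.
  move=> yrs; rewrite -[in LHS](sz_g y yrs) -lead_coefE [in RHS](pgE y yrs).
  by rewrite lead_coefM lead_coefXsubC mul1r.
have g_eval y z : y \in rs -> z \in rs -> y != z -> (g z).[y] = 0.
  move=> yrs zrs yz; rewrite hornerZ horner_prod (big_rem y) //= yz.
  by rewrite hornerXsubC subrr mul0r mulr0.
have dpE y : y \in rs -> p^`().[y] = (g y).[y].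
  move=> yrs; rewrite {1}(pgE y yrs) derivM derivXsubC mul1r.
  by rewrite hornerD hornerM hornerXsubC subrr mul0r addr0.
have gyy y : y \in rs -> (g y).[y] != 0.
  move=> yrs; rewrite hornerZ horner_prod mulf_neq0 //.
  rewrite prodf_seq_neq0; apply/allP => z _; apply/implyP => zy.
  by rewrite hornerXsubC subr_eq0 eq_sym.
pose h := \sum_(y <- rs) (y ^+ m / p^`().[y]) *: g y.
have h_eval y : y \in rs -> h.[y] = y ^+ m.
  move=> yrs; rewrite horner_sum (bigD1_seq y) //= hornerZ dpE //.
  rewrite divfK ?gyy // big_seq_cond big1 ?addr0 // => z /andP[zrs zy].
  by rewrite hornerZ g_eval ?mulr0 // eq_sym.
have hE : h = 'X^m.
  apply/eqP; rewrite -subr_eq0; apply/eqP.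
  apply: (@roots_geq_poly_eq0 _ _ rs) => //.
    apply/allP => y yrs.
    by rewrite /root hornerD hornerN hornerXn h_eval // subrr.
  apply: leq_trans (size_polyD _ _) _; rewrite geq_max size_polyN size_polyXn.
  rewrite (ltnW lt_m) andbT; apply: leq_trans (size_sum _ _ _) _.
  apply/bigmax_leqP_seq => y yrs _.
  by apply: leq_trans (size_scale_leq _ _) _; rewrite sz_g.
have: h`_(size rs).-1 = 0.
  by rewrite hE coefXn gtn_eqF // -ltnS prednK // (leq_trans _ lt_m).
rewrite coef_sum.
rewrite (eq_big_seq (fun y => y ^+ m / p^`().[y] * lead_coef p)); last first.
  by move=> y yrs /=; rewrite coefZ lead_g.
by rewrite -mulr_suml => /eqP; rewrite mulf_eq0 (negPf l0) orbF => /eqP.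
Qed.

(* [A + i x B], with [A] and [B] evaluated at [x ^ 2], is the product of the
   [1 + i x b_j] for [j < N]. *)
Fixpoint parts (F : fieldType) (b : nat -> F) (N : nat) : {poly F} * {poly F} :=
  if N is n.+1 then
    let: (A, B) := parts b n in (A - b n *: (B * 'X), B + b n *: A)
  else (1, 0).

Lemma parts1 (F : fieldType) (b : nat -> F) (N : nat) :
  (parts b N.+1).1 = (parts b N).1 - b N *: ((parts b N).2 * 'X).
Proof. by rewrite /=; case: (parts b N). Qed.

Lemma parts2 (F : fieldType) (b : nat -> F) (N : nat) :
  (parts b N.+1).2 = (parts b N).2 + b N *: (parts b N).1.
Proof. by rewrite /=; case: (parts b N). Qed.

(** Two steps raise the degree by one, the nonzero [b n] keeping the top coefficient alive. Degree
    exactly [M] occurs for the real part at [N = 2M] and for the imaginary part at [N = 2M + 1],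
    which matches the [M] positive zeros; the inequality only carries the induction. *)
Lemma size_parts (F : fieldType) (b : nat -> F) (M : nat) : (forall n, b n != 0) ->
  [/\ size (parts b M.*2).1 = M.+1, (size (parts b M.*2).2 <= M)%N
    & size (parts b M.*2.+1).2 = M.+1].
Proof.
move=> b0; elim: M => [|M [szA szB szB']].
  by rewrite parts2 /= size_poly1 size_poly0 add0r size_scale ?size_poly1.
have szA' : (size (parts b M.*2.+1).1 <= M.+1)%N.
  rewrite parts1; apply: leq_trans (size_polyD _ _) _.
  rewrite geq_max szA leqnn size_polyN.
  apply: leq_trans (size_scale_leq _ _) _; apply: leq_trans (size_polyMleq _ _) _.
  by rewrite size_polyX addn2.
have szA2 : size (parts b M.+1.*2).1 = M.+2.
  rewrite doubleS parts1 addrC.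
  have szBX : size (- (b M.*2.+1 *: ((parts b M.*2.+1).2 * 'X))) = M.+2.
    by rewrite size_polyN size_scale // size_mulX -?size_poly_gt0 szB'.
  by rewrite size_polyDl szBX.
have szB2 : (size (parts b M.+1.*2).2 <= M.+1)%N.
  rewrite doubleS parts2; apply: leq_trans (size_polyD _ _) _.
  by rewrite geq_max szB' leqnn; exact: leq_trans (size_scale_leq _ _) szA'.
split=> //; rewrite parts2 addrC.
by rewrite size_polyDl size_scale // szA2.
Qed.

(** Any functions obeying the recurrence are covered, so the polar forms [poly_re] and [poly_im] can
    be inserted. *)
Lemma horner_parts (F : fieldType) (b : nat -> F) (re im : nat -> F -> F) :
  (forall x, re 0%N x = 1 /\ im 0%N x = 0) ->
  (forall N x, re N.+1 x = re N x - b N * x * im N x) ->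
  (forall N x, im N.+1 x = im N x + b N * x * re N x) ->
  forall N x, re N x = (parts b N).1.[x * x] /\ im N x = x * (parts b N).2.[x * x].
Proof.
move=> H0 Hre Him; elim=> [|N IH] x.
  by have [-> ->] := H0 x; rewrite /= hornerC hornerC mulr0.
rewrite Hre Him parts1 parts2; have [-> ->] := IH x.
by split; rewrite ?hornerD ?hornerN !hornerZ ?hornerMX; ring.
Qed.

Local Notation R := Rdefinitions.R.

Lemma is_derive_horner (p : {poly R}) (x : R) :
  @is_derive R_AbsRing R_NormedModule (fun y : R => p.[y]) x p^`().[x].
Proof.
elim/poly_ind: p => [|p c IH].
  rewrite deriv0 horner0.
  apply: (@is_derive_ext R_AbsRing R_NormedModule (fun _ : R => R0)) => [t|].
    by rewrite horner0.
  exact: (@is_derive_const R_AbsRing R_NormedModule).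
rewrite derivD derivC derivM derivX addr0 mulr1 hornerD hornerM hornerX.
apply: (@is_derive_ext R_AbsRing R_NormedModule
          (fun y : R => Rplus (Rmult p.[y] y) c)) => [t|].
  by rewrite hornerD hornerM hornerX hornerC.
have -> : p^`().[x] * x + p.[x]
    = Rplus (Rplus (Rmult p^`().[x] x) (Rmult p.[x] R1)) R0.
  by rewrite Rmult_1_r Rplus_0_r.
apply: (@is_derive_plus R_AbsRing R_NormedModule (fun y => Rmult p.[y] y) (fun=> c));
  last exact: (@is_derive_const R_AbsRing R_NormedModule).
apply: (@is_derive_mult R_AbsRing (fun y => p.[y]) (fun y => y) x _ _ IH
         (is_derive_id x)).
exact: Rmult_comm.
Qed.

Lemma psumE (f : nat -> R) (n : nat) : psum f n = \sum_(0 <= k < n) f k.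
Proof.
elim: n => [|n IH]; first by rewrite big_nil.
by rewrite big_nat_recr //= IH.
Qed.

Local Open Scope R_scope.

Lemma residue_sum (p : {poly R}) (M m : nat) (r : nat -> R) :
  size p = M.+1 -> (m.+1 < M)%N ->
  (forall k, lt k M -> 0 < r k /\ p.[r k * r k] = 0) ->
  (forall j k, lt j k -> lt k M -> r j <> r k) ->
  psum (fun k => (r k * r k) ^ m / p^`().[r k * r k]) M = 0.
Proof.
move=> sz_p lt_m Hr r_inj.
rewrite (psum_ext _ (fun k => ((r k * r k) ^+ m / p^`().[r k * r k])%R)); last first.
  by move=> k _; rewrite /Rdiv RinvE RpowE.
rewrite psumE; pose rs := [seq r k * r k | k <- iota 0 M].
have <- : (\sum_(y <- rs) y ^+ m / p^`().[y]
    = \sum_(0 <= k < M) (r k * r k) ^+ m / p^`().[r k * r k])%R.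
  by rewrite big_map /index_iota subn0.
have sz_rs : size rs = M by rewrite size_map size_iota.
apply: sum_pow_div_deriv; rewrite ?sz_rs //; last first.
  apply/allP => y /mapP[k]; rewrite mem_iota add0n => /andP[_ /ltP kM] ->.
  by apply/eqP; have [] := Hr k kM.
rewrite map_inj_in_uniq ?iota_uniq // => j k.
rewrite !mem_iota !add0n => /andP[_ /ltP jM] /andP[_ /ltP kM] E.
have [/Rlt_le rj _] := Hr j jM; have [/Rlt_le rk _] := Hr k kM.
have Erk : r j = r k := Rsqr_inj _ _ rj rk E.
by case: (ltngtP j k) => // /ltP jk; [case: (r_inj j k jk kM)|case: (r_inj k j jk jM)].
Qed.

Lemma residue_sum_even (p : {poly R}) (f : R -> R) (M m : nat) (r d : nat -> R) :
  size p = M.+1 -> (forall x, f x = p.[x * x]) ->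
  (forall k, lt k M -> 0 < r k /\ f (r k) = 0 /\ is_derive f (r k) (d k)) ->
  (forall j k, lt j k -> lt k M -> r j <> r k) -> (m.+1 < M)%N ->
  psum (fun k => r k ^ (2 * m + 1) / d k) M = 0.
Proof.
move=> sz_p fE Hr r_inj lt_m.
have RS : psum (fun k => (r k * r k) ^ m / p^`().[r k * r k]) M = 0.
  apply: residue_sum => // k kM.
  by have [rk [fk _]] := Hr k kM; rewrite -fE.
rewrite -(Rmult_0_r (/ 2)) -RS -psum_scal.
apply: psum_ext => k kM; have [rk [_ dk]] := Hr k kM.
rewrite -ratio_even //; congr (_ / _).
rewrite -(is_derive_unique _ _ _ dk); apply: is_derive_unique.
apply: (@is_derive_ext R_AbsRing R_NormedModule (fun y : R => p.[y * y])) => //.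
exact: is_derive_comp_sqr (is_derive_horner p _).
Qed.

Lemma residue_sum_odd (p : {poly R}) (f : R -> R) (M m : nat) (r d : nat -> R) :
  size p = M.+1 -> (forall x, f x = x * p.[x * x]) ->
  (forall k, lt k M -> 0 < r k /\ f (r k) = 0 /\ is_derive f (r k) (d k)) ->
  (forall j k, lt j k -> lt k M -> r j <> r k) -> (m.+1 < M)%N ->
  psum (fun k => r k ^ (2 * m + 2) / d k) M = 0.
Proof.
move=> sz_p fE Hr r_inj lt_m.
have p_root k : lt k M -> p.[r k * r k] = 0.
  move=> kM; have [rk [fk _]] := Hr k kM.
  by move: fk; rewrite fE => /Rmult_integral[rk0|//]; move: rk; rewrite rk0 => /Rlt_irrefl.
have RS : psum (fun k => (r k * r k) ^ m / p^`().[r k * r k]) M = 0.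
  by apply: residue_sum => // k kM; split; [have [] := Hr k kM|exact: p_root].
rewrite -(Rmult_0_r (/ 2)) -RS -psum_scal.
apply: psum_ext => k kM; have [rk [_ dk]] := Hr k kM.
rewrite -ratio_odd //; congr (_ / _).
rewrite -(is_derive_unique _ _ _ dk) -[RHS]Rplus_0_l -(p_root k kM).
apply: is_derive_unique.
apply: (@is_derive_ext R_AbsRing R_NormedModule (fun y : R => y * p.[y * y])) => //.
exact: is_derive_mul_comp_sqr (is_derive_horner p _).
Qed.

(** * Residue sums of the truncated products *)

Section Recurrence.

Context (b : nat -> R) (re im : nat -> R -> R).
Hypothesis b_neq0 : forall n, b n <> 0.
Hypothesis re_im_0 : forall x, re O x = 1 /\ im O x = 0.
Hypothesis re_S : forall N x, re (S N) x = re N x - b N * x * im N x.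
Hypothesis im_S : forall N x, im (S N) x = im N x + b N * x * re N x.
Context (M m : nat) (r d : nat -> R).
Hypothesis r_inj : forall j k, lt j k -> lt k M -> r j <> r k.
Hypothesis m_lt : lt (S m) M.

Let b_neqb n : (b n != 0)%R.
Proof. exact/eqP/b_neq0. Qed.

(** For [N = 2M + 1] the imaginary part is [x] times a polynomial of degree [M] in x^2. The extra
    factor makes the exponents even and at least 2, against odd ones for the real part. *)
Lemma residue_sum_im (N : nat) : N = S (Nat.mul 2 M) ->
  (forall k, lt k M ->
     0 < r k /\ im N (r k) = 0 /\ is_derive (im N) (r k) (d k)) ->
  psum (fun k => r k ^ (Nat.add (Nat.mul 2 m) 2) / d k) M = 0.
Proof.
move=> NE Hr; apply: (residue_sum_odd (p := (parts b N).2)) Hr r_inj _.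
- have -> : N = M.*2.+1 by rewrite NE multE mul2n.
  by have [] := size_parts M b_neqb.
- by move=> x; have [] := horner_parts re_im_0 re_S im_S N x.
- exact/ltP.
Qed.

Lemma residue_sum_re (N : nat) : N = Nat.mul 2 M ->
  (forall k, lt k M ->
     0 < r k /\ re N (r k) = 0 /\ is_derive (re N) (r k) (d k)) ->
  psum (fun k => r k ^ (Nat.add (Nat.mul 2 m) 1) / d k) M = 0.
Proof.
move=> NE Hr; apply: (residue_sum_even (p := (parts b N).1)) Hr r_inj _.
- have -> : N = M.*2 by rewrite NE multE mul2n.
  by have [] := size_parts M b_neqb.
- by move=> x; have [] := horner_parts re_im_0 re_S im_S N x.
- exact/ltP.
Qed.

End Recurrence.

End PolynomialRoots.

(** * Zeros and slopes *)

Lemma sin_plus_nat_PI (u : R) (n : nat) : sin (u + INR n * PI) = (-1) ^ n * sin u.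
Proof.
  induction n as [|n IH]; [simpl; rewrite Rmult_0_l, Rplus_0_r; ring|].
  rewrite S_INR. replace (u + (INR n + 1) * PI) with (u + INR n * PI + PI) by ring.
  rewrite neg_sin, IH. simpl. ring.
Qed.

Lemma cos_nat_PI (n : nat) : cos (INR n * PI) = (-1) ^ n.
Proof.
  induction n as [|n IH]; [simpl; rewrite Rmult_0_l; apply cos_0|].
  rewrite S_INR. replace ((INR n + 1) * PI) with (INR n * PI + PI) by ring.
  rewrite neg_cos, IH. simpl. ring.
Qed.

(* Coquelicot's [Lim f x] is by definition the limit along [x + 1 / (n + 1)]. *)
Lemma C_derive_real (F : C -> C) (f : R -> R) (x l : R) :
  (forall y, F (RtoC y) = RtoC (f y)) ->
  is_lim_seq (fun n => (f (x + / (INR n + 1)) - f x) / / (INR n + 1)) l ->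
  C_derive F (RtoC x) = RtoC l.
Proof.
  intros HF Hl.
  set (quot := fun n => ((F (Rbar_loc_seq x n, 0) - F (RtoC x))
                / ((Rbar_loc_seq x n, 0) - RtoC x))%C).
  assert (Hquot : forall n,
    quot n = RtoC ((f (x + / (INR n + 1)) - f x) / / (INR n + 1))).
  { intros n. unfold quot. simpl.
    change (x + / (INR n + 1), 0) with (RtoC (x + / (INR n + 1))).
    rewrite !HF, <- !RtoC_minus.
    replace (x + / (INR n + 1) - x) with (/ (INR n + 1)) by ring.
    rewrite <- RtoC_div; [reflexivity|].
    apply Rinv_neq_0_compat. pose proof (pos_INR n). lra. }
  change (C_derive F (RtoC x)) with
    (real (Lim_seq (fun n => fst (quot n))), real (Lim_seq (fun n => snd (quot n)))).
  rewrite (Lim_seq_ext (fun n => fst (quot n)) _ (fun n => f_equal fst (Hquot n))),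
    (Lim_seq_ext (fun n => snd (quot n)) _ (fun n => f_equal snd (Hquot n))).
  simpl. now rewrite (is_lim_seq_unique _ _ Hl), Lim_seq_const.
Qed.

Lemma inv_nat_lim : is_lim_seq (fun n => / (INR n + 1)) 0.
Proof.
  apply (is_lim_seq_inv (fun n => INR n + 1) p_infty); [|discriminate].
  apply (is_lim_seq_plus _ _ p_infty 1 p_infty); [apply is_lim_seq_INR| |reflexivity].
  apply is_lim_seq_const.
Qed.

Section Zeros.

Context (q : R) (Hq : 0 < q < 1).
Context (x : nat -> R) (delta : R).
Hypothesis x_pos : forall k, 0 < x k.
Hypothesis x_phase : forall k, phase q (x k) = INR (S k) * PI - delta.

Notation b := (qb q).
Notation h := (qseries q cauchy_kernel).

(** The derivative of |E_q| sin (phi + delta) at a zero: the derivative of the modulus is multiplied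
    by a vanishing sine, the cosine is a sign, and phi'(x) = h(x) / x. The power is [S k] because
    index [k] is zero number k + 1. *)
Definition zero_slope (k : nat) : R :=
  (-1) ^ S k * (modulus q (x k) * (h (x k) / x k)).

(** Termwise differentiation, along the increments that [C_derive] samples. The quotient of the
    [j]-th term is dominated by [b j], since [atan] is 1-Lipschitz. *)
Lemma phase_slope_lim (y : R) : 0 < y ->
  is_lim_seq
    (fun n => (phase q (y + / (INR n + 1)) - phase q y) / / (INR n + 1)) (h y / y).
Proof.
  intros Hy.
  set (e := fun n => / (INR n + 1)).
  assert (He : forall n, 0 < e n).
  { intros n. apply Rinv_0_lt_compat. pose proof (pos_INR n). lra. }
  apply is_lim_seq_ext with
    (fun n => Series (fun j => (atan (b j * (y + e n)) - atan (b j * y)) / e n)).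
  { intros n. fold (e n). specialize (He n). unfold phase, qseries.
    rewrite <- Series_minus by (apply ex_qseries; auto using tame_atan).
    unfold Rdiv. now rewrite Series_scal_r. }
  replace (h y / y) with (Series (fun j => b j * / (1 + (b j * y) ^ 2))).
  2: { unfold qseries, Rdiv. rewrite <- Series_scal_r. apply Series_ext. intros j.
       unfold cauchy_kernel. pose proof (pow2_ge_0 (b j * y)). field. nra. }
  apply (tannery _ _ b 0).
  - exists 1. now apply qb_series.
  - intros n j _. specialize (He n). pose proof (qb_pos q Hq j).
    assert (H1 := atan_lipschitz (b j * y) (b j * (y + e n)) ltac:(nra)).
    rewrite Rabs_pos_eq by (apply Rle_mult_inv_pos; lra).
    apply Rle_div_l; nra.
  - intros j. pose proof (qb_pos q Hq j) as Hb.
    assert (Hd : is_derive (fun t => atan (b j * t)) y (b j * / (1 + (b j * y) ^ 2))).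
    { apply (is_derive_comp atan (fun t => b j * t) y).
      - apply is_derive_Reals, derivable_pt_lim_atan.
      - auto_derive; [exact I|ring]. }
    apply is_derive_Reals in Hd.
    apply is_lim_seq_spec. intros eps.
    destruct (Hd eps (cond_pos eps)) as [d Hd'].
    assert (HL := inv_nat_lim). apply is_lim_seq_spec in HL.
    destruct (HL d) as [n0 Hn0]. exists n0. intros n Hn.
    specialize (Hn0 n Hn). rewrite Rminus_0_r in Hn0. specialize (He n).
    apply Hd'; [unfold e in *; lra|exact Hn0].
Qed.

(** [Sin_q] for [delta = 0] and [Cos_q] for [delta = PI / 2]. *)
Definition phase_sine (y : R) : R := modulus q y * sin (phase q y + delta).

(** With [u] the increment of the phase, the difference quotient at a zero is a sign times modulus,
    sin u / u and u / e; continuity of the modulus suffices. *)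
Lemma phase_sine_slope (k : nat) :
  is_lim_seq
    (fun n => (phase_sine (x k + / (INR n + 1)) - phase_sine (x k)) / / (INR n + 1))
    (zero_slope k).
Proof.
  set (e := fun n => / (INR n + 1)).
  assert (He : forall n, 0 < e n).
  { intros n. apply Rinv_0_lt_compat. pose proof (pos_INR n). lra. }
  set (u := fun n => phase q (x k + e n) - phase q (x k)).
  assert (Hu : forall n, 0 < u n).
  { intros n. apply Rlt_0_minus, phase_increasing; [exact Hq|]. specialize (He n). lra. }
  assert (Hxe : is_lim_seq (fun n => x k + e n) (x k)).
  { replace (Finite (x k)) with (Finite (x k + 0)) by (f_equal; ring).
    apply is_lim_seq_plus'; [apply is_lim_seq_const|apply inv_nat_lim]. }
  assert (Hu0 : is_lim_seq u 0).
  { replace (Finite 0) with (Finite (phase q (x k) - phase q (x k))) by (f_equal; ring).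
    apply is_lim_seq_minus'; [|apply is_lim_seq_const].
    now apply (qseries_lim q Hq atan _ _ tame_atan). }
  apply is_lim_seq_ext with
    (fun n => (-1) ^ S k * (modulus q (x k + e n) * ((sin (u n) / u n) * (u n / e n)))).
  { intros n. fold (e n). specialize (He n). specialize (Hu n).
    unfold phase_sine.
    replace (phase q (x k + e n) + delta) with (u n + INR (S k) * PI)
      by (unfold u; rewrite x_phase; ring).
    replace (phase q (x k) + delta) with (0 + INR (S k) * PI)
      by (rewrite x_phase; ring).
    rewrite !sin_plus_nat_PI, sin_0. field. lra. }
  unfold zero_slope.
  apply (is_lim_seq_scal_l _ ((-1) ^ S k) (modulus q (x k) * (h (x k) / x k))).
  apply is_lim_seq_mult'.
  - apply (is_lim_seq_continuous exp _ (qseries q half_ln (x k)));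
      [apply derivable_continuous, derivable_exp|].
    now apply (qseries_lim q Hq half_ln _ _ tame_half_ln).
  - replace (h (x k) / x k) with (1 * (h (x k) / x k)) by ring.
    apply is_lim_seq_mult'; [|now apply phase_slope_lim].
    (* The limit of sin t / t is punctured at 0; strict monotonicity of the phase keeps [u] away
       from it. *)
    apply (is_lim_comp_seq (fun t => sin t / t) u 0 1); [apply is_lim_sinc_0| |exact Hu0].
    exists O. intros n _ E. specialize (Hu n). injection E. lra.
Qed.

(** The next zero lies [PI] higher in phase, but dividing by [q] gains less than [PI / 2]. *)
Lemma zero_step (k : nat) : x k / q <= x (S k).
Proof.
  apply Rnot_lt_le. intros H. apply (phase_increasing q Hq) in H.
  rewrite phase_div_q, !x_phase in H by exact Hq.
  pose proof (atan_bound ((1 - q) * x k / q)). pose proof PI_RGT_0.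
  rewrite (S_INR (S k)) in H. lra.
Qed.

Lemma zero_growth (k : nat) : x 0 * (/ q) ^ k <= x k.
Proof.
  assert (0 < / q) by (apply Rinv_0_lt_compat; lra).
  induction k as [|k IH]; [simpl; lra|].
  eapply Rle_trans; [|apply zero_step].
  simpl. unfold Rdiv. nra.
Qed.

Lemma zero_ge_first (k : nat) : x 0 <= x k.
Proof.
  eapply Rle_trans; [|apply zero_growth].
  rewrite <- (Rmult_1_r (x 0)) at 1. pose proof (x_pos 0).
  apply Rmult_le_compat_l; [lra|]. rewrite <- (pow1 k). apply pow_incr.
  split; [lra|]. rewrite <- Rinv_1. apply Rinv_le_contravar; lra.
Qed.

Lemma ex_series_zero_power (s : R) : 0 < s -> ex_series (fun k => exp (- s * ln (x k))).
Proof.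
  intros Hs.
  apply (ex_series_abs_le _ (fun k => exp (- s * ln (x 0)) * exp (s * ln q) ^ k)).
  - intros k. rewrite Rabs_pos_eq by apply Rlt_le, exp_pos.
    replace (exp (s * ln q) ^ k) with (exp (- s * (INR k * ln (/ q)))).
    + rewrite <- exp_plus.
      assert (Hl : ln (x 0) + INR k * ln (/ q) <= ln (x k)).
      { assert (0 < / q) by (apply Rinv_0_lt_compat; lra).
        rewrite <- ln_pow, <- ln_mult by (auto using pow_lt).
        apply ln_le; [|apply zero_growth].
        apply Rmult_lt_0_compat; auto using pow_lt. }
      assert (Hle : - s * ln (x k) <= - s * ln (x 0) + - s * (INR k * ln (/ q))) by nra.
      destruct Hle as [Hle| ->]; [apply Rlt_le, exp_increasing, Hle|lra].
    + rewrite ln_Rinv by lra. rewrite <- Rpower_pow by apply exp_pos.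
      unfold Rpower. rewrite ln_exp. f_equal. ring.
  - apply (ex_series_scal_l (exp (- s * ln (x 0))) (fun k => exp (s * ln q) ^ k)).
    exists (/ (1 - exp (s * ln q))). apply is_series_geom.
    rewrite Rabs_pos_eq by apply Rlt_le, exp_pos.
    rewrite <- exp_0. apply exp_increasing.
    assert (ln q < ln 1) by (apply ln_increasing; lra). rewrite ln_1 in *. nra.
Qed.

Lemma ex_series_zero_inv : ex_series (fun k => / x k).
Proof.
  apply (ex_series_ext (fun k => exp (- (1) * ln (x k)))).
  - intros k. replace (- (1) * ln (x k)) with (- ln (x k)) by ring.
    rewrite exp_Ropp, exp_ln; auto.
  - apply ex_series_zero_power. lra.
Qed.

(** The lower bound of [qseries_kernel_lower] at the first zero; being increasing in [x], it holds
    at all the others. *)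
Definition kernel_inf : R := q / (1 - q) * atan ((1 - q) * x 0 / q).

Lemma kernel_inf_pos : 0 < kernel_inf.
Proof.
  apply Rmult_lt_0_compat; [apply Rdiv_lt_0_compat; lra|].
  rewrite <- atan_0. apply atan_increasing. pose proof (x_pos 0).
  apply Rdiv_lt_0_compat; nra.
Qed.

Lemma kernel_inf_le (k : nat) : kernel_inf <= h (x k).
Proof.
  eapply Rle_trans; [|apply (qseries_kernel_lower q Hq (x k) (x_pos k))].
  apply Rmult_le_compat_l; [apply Rlt_le, Rdiv_lt_0_compat; lra|].
  assert (H : (1 - q) * x 0 / q <= (1 - q) * x k / q).
  { apply Rmult_le_compat_r; [apply Rlt_le, Rinv_0_lt_compat; lra|].
    apply Rmult_le_compat_l; [lra|apply zero_ge_first]. }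
  destruct H as [H| ->]; [apply Rlt_le, atan_increasing, H|lra].
Qed.

Lemma zero_slope_inv_abs (k : nat) :
  Rabs (/ zero_slope k) <= x k / (modulus q (x k) * kernel_inf).
Proof.
  pose proof (kernel_inf_le k). pose proof kernel_inf_pos. pose proof (x_pos k).
  assert (0 < modulus q (x k)) by apply exp_pos.
  unfold zero_slope. rewrite Rabs_inv, Rabs_mult, pow_1_abs, Rmult_1_l.
  rewrite Rabs_pos_eq.
  2: { apply Rlt_le, Rmult_lt_0_compat; [|apply Rdiv_lt_0_compat]; lra. }
  replace (/ (modulus q (x k) * (h (x k) / x k)))
    with (x k * / (modulus q (x k) * h (x k))) by (field; lra).
  apply Rmult_le_compat_l; [lra|].
  apply Rinv_le_contravar; [nra|]. apply Rmult_le_compat_l; lra.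
Qed.

(** The modulus cancels between the comparison [Eq_real_le_modulus] and the slope, leaving a single
    factor [x k]. This is the origin of the condition [1 < Re s]. *)
Lemma majorant_slope_bound (k : nat) :
  Eq_real q (x k) * Rabs (/ zero_slope k) <= exp (kernel_sup q) / kernel_inf * x k.
Proof.
  pose proof kernel_inf_pos. pose proof (x_pos k).
  assert (0 < modulus q (x k)) by apply exp_pos.
  replace (exp (kernel_sup q) / kernel_inf * x k)
    with (modulus q (x k) * exp (kernel_sup q) * (x k / (modulus q (x k) * kernel_inf)))
    by (field; lra).
  apply Rmult_le_compat.
  - apply (psum_le_Series _ 0); [|apply ex_Eq_series; [exact Hq|lra]].
    intros; apply Eq_term_nonneg; [exact Hq|lra].
  - apply Rabs_pos.
  - now apply Eq_real_le_modulus.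
  - apply zero_slope_inv_abs.
Qed.

(** Here the modulus is not cancelled and beats every power, hence convergence of the eta series for
    all [s]. In [p + 2], one power absorbs the [x k] from the slope and one leaves the summable
    [/ x k]. *)
Lemma power_slope_bound (p : nat) :
  exists K, forall k, x k ^ p * Rabs (/ zero_slope k) <= K * / x k.
Proof.
  destruct (modulus_poly_lower q Hq (p + 2)) as (K & HK & H).
  pose proof kernel_inf_pos as Hc.
  exists (/ (K * kernel_inf)). intros k. pose proof (x_pos k).
  assert (Hp : 0 < x k ^ p) by (apply pow_lt; lra).
  assert (Hm : K * x k ^ (p + 2) <= modulus q (x k)).
  { eapply Rle_trans; [apply (H (p + 2)%nat); [lia|lra]|].
    apply modulus_ge_qsum; [exact Hq|lra]. }
  rewrite pow_add in Hm. simpl (x k ^ 2) in Hm.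
  assert (HK' : 0 < K * (x k ^ p * (x k * (x k * 1)))) by (repeat apply Rmult_lt_0_compat; lra).
  eapply Rle_trans; [apply Rmult_le_compat_l; [lra|apply zero_slope_inv_abs]|].
  replace (/ (K * kernel_inf) * / x k) with
    (x k ^ p * (x k / (K * (x k ^ p * (x k * (x k * 1))) * kernel_inf)))
    by (field; repeat split; lra).
  apply Rmult_le_compat_l; [lra|]. apply Rmult_le_compat_l; [lra|].
  apply Rinv_le_contravar; [nra|]. apply Rmult_le_compat_r; lra.
Qed.

End Zeros.

(** * Vanishing of the residue sums at the zeros *)

Section Termination.

Context (q : R) (Hq : 0 < q < 1).
Context (x : nat -> R) (delta : R).
Hypothesis x_pos : forall k, 0 < x k.
Hypothesis x_phase : forall k, phase q (x k) = INR (S k) * PI - delta.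

Notation b := (qb q).
Notation angle k := (INR (S k) * PI - delta).

Definition trunc_sine (N : nat) (y : R) : R :=
  exp (qsum q half_ln N y) * sin (qsum q atan N y + delta).

Definition trunc_slope (N k : nat) (r : R) : R :=
  (-1) ^ S k * (exp (qsum q half_ln N r) * (qsum q cauchy_kernel N r / r)).

Lemma is_derive_qsum (g g' : R -> R) (N : nat) (y : R) :
  (forall t, is_derive g t (g' t)) ->
  is_derive (qsum q g N) y (psum (fun j => b j * g' (b j * y)) N).
Proof.
  intros Hg. induction N as [|N IH].
  - apply (is_derive_ext (fun _ => 0)); [reflexivity|].
    apply @is_derive_const.
  - apply (is_derive_ext (fun t => plus (qsum q g N t) (g (b N * t)))); [reflexivity|].
    apply @is_derive_plus; [exact IH|].
    apply (is_derive_comp g (fun t => b N * t)); [apply Hg|].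
    auto_derive; [exact I|ring].
Qed.

Lemma is_derive_trunc_sine (N k : nat) (r : R) :
  0 < r -> qsum q atan N r = angle k ->
  is_derive (trunc_sine N) r (trunc_slope N k r).
Proof.
  intros Hr Hroot.
  assert (Ha : is_derive (qsum q atan N) r (qsum q cauchy_kernel N r / r)).
  { replace (qsum q cauchy_kernel N r / r)
      with (psum (fun j => b j * / (1 + (b j * r) ^ 2)) N).
    - apply (is_derive_qsum atan (fun t => / (1 + t ^ 2))).
      intros t. apply is_derive_Reals, derivable_pt_lim_atan.
    - unfold Rdiv. rewrite Rmult_comm. unfold qsum. rewrite <- psum_scal.
      apply psum_ext. intros j _. unfold cauchy_kernel.
      pose proof (pow2_ge_0 (b j * r)). field. nra. }
  assert (Hl := is_derive_qsum half_ln cauchy_kernel N r).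
  assert (Hl' : forall t, is_derive half_ln t (cauchy_kernel t)).
  { intros t. unfold half_ln, cauchy_kernel. auto_derive; [nra|]. field. nra. }
  (* [e] will be multiplied by a sine that vanishes at [r], so it stays abstract. *)
  specialize (Hl Hl'). set (e := psum _ _) in Hl.
  unfold trunc_sine.
  set (A := qsum q atan N) in *. set (L := qsum q half_ln N) in *.
  set (a := qsum q cauchy_kernel N r / r) in *.
  assert (He : is_derive (fun t => exp (L t)) r (e * exp (L r)))
    by exact (is_derive_comp exp L r _ _ (is_derive_exp (L r)) Hl).
  assert (Had : is_derive (fun t => A t + delta) r a).
  { rewrite <- (Rplus_0_r a).
    exact (is_derive_plus A (fun _ => delta) r a 0 Ha (is_derive_const delta r)). }
  assert (Hs : is_derive (fun t => sin (A t + delta)) r (a * cos (A r + delta)))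
    by exact (is_derive_comp sin _ r _ _ (is_derive_sin (A r + delta)) Had).
  replace (trunc_slope N k r)
    with (e * exp (L r) * sin (A r + delta) + exp (L r) * (a * cos (A r + delta))).
  - exact (is_derive_mult _ _ r _ _ He Hs Rmult_comm).
  - rewrite Hroot. replace (angle k + delta) with (INR (S k) * PI) by ring.
    rewrite cos_nat_PI. replace (INR (S k) * PI) with (0 + INR (S k) * PI) by ring.
    rewrite sin_plus_nat_PI, sin_0.
    unfold trunc_slope. fold (L r) a. ring.
Qed.

(** The relation on [N M] puts the largest angle, number [M], exactly [PI / 2] below the supremum of
    the truncated phase. The truncation thus has exactly [M] positive zeros, and
    [qsum_kernel_lower_gap] applies at each of them. *)
Lemma termination (p : nat) (N : nat -> nat) (M0 : nat) :
  (forall M, (M <= N M)%nat) ->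
  (forall M, INR (N M) * (PI / 2) = INR M * PI - delta + PI / 2) ->
  (forall M (r d : nat -> R), (M0 <= M)%nat ->
     (forall j k, (j < k)%nat -> (k < M)%nat -> r j <> r k) ->
     (forall k, (k < M)%nat -> 0 < r k /\ trunc_sine (N M) (r k) = 0 /\
        is_derive (trunc_sine (N M)) (r k) (d k)) ->
     psum (fun k => r k ^ p / d k) M = 0) ->
  Series (fun k => x k ^ p / zero_slope q x k) = 0.
Proof.
  intros HNM HN Hfin. assert (HPI := PI_RGT_0).
  assert (Hangle : forall k, 0 < angle k).
  { intros k. rewrite <- x_phase, <- (phase_0 q).
    now apply phase_increasing. }
  (* The bound on [k] sits under the existential, with a dummy witness outside it, so that choice
     yields a total function [r]. *)
  assert (Hex : forall M k, exists r, (k < M)%nat ->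
            0 < r /\ qsum q atan (N M) r = angle k).
  { intros M k. destruct (lt_dec k M) as [H|H]; [|exists 0; lia].
    destruct (qsum_atan_onto q Hq (N M) (angle k)) as (r & Hr & E).
    - split; [apply Hangle|]. rewrite HN.
      assert (INR (S k) <= INR M) by (apply le_INR; lia). nra.
    - exists r. auto. }
  set (r := fun M k => proj1_sig (constructive_indefinite_description _ (Hex M k))).
  assert (Hr : forall M k, (k < M)%nat -> 0 < r M k /\ qsum q atan (N M) (r M k) = angle k).
  { intros M k. unfold r. now destruct constructive_indefinite_description. }
  clearbody r. clear Hex.
  (* The truncated phase is below the full one and reaches each level later. *)
  assert (Hge : forall M k, (k < M)%nat -> x k <= r M k).
  { intros M k H. destruct (Hr M k H) as [Hpos E]. apply Rnot_lt_le. intros Hlt.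
    apply (phase_increasing q Hq) in Hlt.
    pose proof (qsum_atan_le_phase q Hq (N M) (r M k) ltac:(lra)).
    rewrite x_phase in Hlt. lra. }
  assert (Hlim : forall k, is_lim_seq (fun M => r M k) (x k)).
  { intros k. apply is_lim_seq_spec. intros eps.
    assert (Hphi : phase q (x k) < phase q (x k + eps)).
    { apply phase_increasing; [exact Hq|]. pose proof (cond_pos eps). lra. }
    assert (HL : is_lim_seq (fun M => qsum q atan (N M) (x k + eps)) (phase q (x k + eps))).
    { apply (qsum_lim q Hq atan N (fun _ => x k + eps)); auto using tame_atan.
      apply is_lim_seq_const. }
    apply is_lim_seq_spec in HL.
    (* The tolerance is the phase gained between [x k] and [x k + eps]: eventually the truncated
       phase exceeds the angle at [x k + eps], so its zero lies to the left. *)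
    destruct (HL (mkposreal _ (proj2 (Rlt_0_minus _ _) Hphi))) as [n0 Hn0].
    exists (Nat.max n0 (S k)). intros M HM.
    specialize (Hn0 M ltac:(lia)). simpl in Hn0. apply Rabs_def2 in Hn0.
    specialize (Hge M k ltac:(lia)).
    destruct (Hr M k ltac:(lia)) as [Hpos E].
    assert (r M k < x k + eps).
    { apply Rnot_le_lt. intros H.
      pose proof (qsum_atan_lipschitz q Hq (N M) _ _ H). rewrite x_phase in *. lra. }
    apply Rabs_def1; lra. }
  set (d := fun M k => trunc_slope (N M) k (r M k)).
  assert (Hzero : forall M, (M0 <= M)%nat -> psum (fun k => r M k ^ p / d M k) M = 0).
  { intros M HM. apply Hfin; [exact HM| |].
    - intros j k Hjk Hk E.
      destruct (Hr M j ltac:(lia)) as [_ Ej]. destruct (Hr M k Hk) as [_ Ek].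
      rewrite E, Ek in Ej. apply lt_INR in Hjk. rewrite !S_INR in Ej. nra.
    - intros k Hk. destruct (Hr M k Hk) as [Hpos E]. split; [exact Hpos|]. split.
      + unfold trunc_sine. rewrite E.
        replace (angle k + delta) with (0 + INR (S k) * PI) by ring.
        rewrite sin_plus_nat_PI, sin_0. ring.
      + now apply is_derive_trunc_sine. }
  destruct (qsum_kernel_lower_gap q Hq (x 0%nat) (x_pos 0)) as (c & Hc & Hgap).
  destruct (modulus_poly_lower q Hq (p + 2)) as (K & HK & Hmod).
  assert (HL : is_lim_seq (fun M => psum (fun k => r M k ^ p / d M k) M)
                 (Series (fun k => x k ^ p / zero_slope q x k))).
  (* The start [p + 2] guarantees the [p + 2] factors used by [Hmod], since [N M >= M]. *)
  { apply (tannery_psum _ _ (fun k => / (K * c) * / x k) (fun M => M) (p + 2)).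
    - apply (ex_series_scal_l (/ (K * c)) (fun k => / x k)).
      now apply (ex_series_zero_inv q Hq x delta).
    - intros k. pose proof (x_pos k). apply Rlt_le.
      assert (0 < K * c) by nra.
      apply Rmult_lt_0_compat; apply Rinv_0_lt_compat; assumption.
    - auto.
    - intros M k HM Hk. destruct (Hr M k Hk) as [Hpos E].
      specialize (Hge M k Hk). pose proof (x_pos k) as Hxk.
      set (y := r M k) in *.
      assert (Hh : c <= qsum q cauchy_kernel (N M) y).
      { apply Hgap.
        - eapply Rle_trans; [apply (zero_ge_first q Hq x delta x_pos x_phase k)|exact Hge].
        - rewrite E, HN. assert (INR (S k) <= INR M) by (apply le_INR; lia). nra. }
      assert (Hm : K * y ^ (p + 2) <= exp (qsum q half_ln (N M) y)).
      { apply Hmod; [specialize (HNM M); lia|exact Hpos]. }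
      assert (Hyp : 0 < y ^ p) by (apply pow_lt; lra).
      rewrite pow_add in Hm. simpl (y ^ 2) in Hm.
      set (m := exp (qsum q half_ln (N M) y)) in *.
      set (hh := qsum q cauchy_kernel (N M) y) in *.
      assert (Hm0 : 0 < K * (y ^ p * (y * (y * 1))))
        by (repeat apply Rmult_lt_0_compat; lra).
      unfold Rdiv, d, trunc_slope. fold y m hh.
      rewrite Rabs_mult, Rabs_inv, Rabs_mult, pow_1_abs, Rmult_1_l.
      rewrite !Rabs_pos_eq.
      2: { apply Rlt_le, Rmult_lt_0_compat; [|apply Rdiv_lt_0_compat]; lra. }
      2: lra.
      (* Bound first at the moving zero [y], then by [x k <= y], so that the majorant does not
         depend on [M]. *)
      apply Rle_trans with (/ (K * c) * / y).
      + replace (/ (K * c) * / y) with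
          (y ^ p * (y * / (K * (y ^ p * (y * (y * 1))) * c)))
          by (field; repeat split; lra).
        replace (/ (m * (hh / y))) with (y * / (m * hh)) by (field; lra).
        apply Rmult_le_compat_l; [lra|]. apply Rmult_le_compat_l; [lra|].
        apply Rinv_le_contravar; [nra|]. apply Rmult_le_compat; lra.
      + apply Rmult_le_compat_l; [apply Rlt_le, Rinv_0_lt_compat; nra|].
        now apply Rinv_le_contravar.
    - intros k.
      assert (Hs0 : zero_slope q x k <> 0).
      { pose proof (kernel_inf_le q Hq x delta x_pos x_phase k).
        pose proof (kernel_inf_pos q Hq x x_pos).
        pose proof (x_pos k). unfold zero_slope.
        apply Rmult_integral_contrapositive_currified; [apply pow_nonzero; lra|].
        apply Rgt_not_eq, Rmult_lt_0_compat; [apply exp_pos|apply Rdiv_lt_0_compat; lra]. }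
      apply is_lim_seq_div'; [| |exact Hs0].
      + apply (is_lim_seq_continuous (fun y => y ^ p) _ (x k)); [|apply Hlim].
        apply derivable_continuous_pt, derivable_pt_pow.
      + unfold d, trunc_slope, zero_slope.
        apply (is_lim_seq_scal_l _ ((-1) ^ S k)
                 (modulus q (x k) * (qseries q cauchy_kernel (x k) / x k))).
        apply is_lim_seq_mult'.
        * apply (is_lim_seq_continuous exp _ (qseries q half_ln (x k)));
            [apply derivable_continuous, derivable_exp|].
          now apply (qsum_lim q Hq half_ln N (fun M => r M k) _ tame_half_ln).
        * apply is_lim_seq_div'; [|apply Hlim|apply Rgt_not_eq, x_pos].
          now apply (qsum_lim q Hq cauchy_kernel N (fun M => r M k) _ tame_cauchy_kernel). }
  assert (HL0 : is_lim_seq (fun M => psum (fun k => r M k ^ p / d M k) M) 0).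
  { apply is_lim_seq_ext_loc with (fun _ => 0); [|apply is_lim_seq_const].
    exists M0. intros M HM. now rewrite Hzero. }
  apply is_lim_seq_unique in HL. apply is_lim_seq_unique in HL0.
  rewrite HL in HL0. now injection HL0.
Qed.

End Termination.

(** * Complex exponents and the exchange of sums *)

Lemma is_Cseries_parts (a : nat -> C) (l : C) :
  is_series (fun n => Re (a n)) (Re l) -> is_series (fun n => Im (a n)) (Im l) ->
  is_Cseries a l.
Proof.
  intros Hre Him. apply filterlim_locally. intros eps.
  assert (Hs : forall n, sum_n a n
    = (sum_n (fun n => Re (a n)) n, sum_n (fun n => Im (a n)) n)).
  { induction n as [|n IH].
    - rewrite !sum_O. now destruct (a O).
    - rewrite !sum_Sn, IH. reflexivity. }
  generalize (filter_and _ _ (proj1 (filterlim_locally _ _) Hre eps)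
                (proj1 (filterlim_locally _ _) Him eps)). apply filter_imp.
  intros n [H1 H2]. rewrite Hs. split; assumption.
Qed.

Lemma CSeries_correct (a : nat -> C) (M : nat -> R) :
  ex_series M -> (forall k, Rabs (Re (a k)) <= M k /\ Rabs (Im (a k)) <= M k) ->
  is_Cseries a (CSeries a).
Proof.
  intros HM Ha. apply is_Cseries_parts; apply Series_correct, (ex_series_abs_le _ M);
    try exact HM; apply Ha.
Qed.

Lemma is_Cseries_finite (a : nat -> C) (l : C) (n : nat) :
  is_Cseries a l -> (forall j, (n < j)%nat -> a j = RtoC 0) -> l = sum_n a n.
Proof.
  intros Hl Ha. symmetry.
  apply (filterlim_locally_unique (V := C_NormedModule) (F := eventually) (sum_n a)); [|exact Hl].
  apply (filterlim_ext_loc (fun _ => sum_n a n)); [|apply filterlim_const].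
  exists n. intros m Hm. induction Hm as [|m Hm IH]; [reflexivity|].
  rewrite sum_Sn, <- IH, Ha by lia. symmetry. apply (plus_zero_r (G := C_AbelianGroup)).
Qed.

Lemma inv_Rcpow (x : R) (s : C) :
  (RtoC 1 / Rcpow x s)%C
    = (exp (- Re s * ln x) * cos (Im s * ln x),
       - (exp (- Re s * ln x) * sin (Im s * ln x))).
Proof.
  set (w := (exp (- Re s * ln x) * cos (Im s * ln x),
       - (exp (- Re s * ln x) * sin (Im s * ln x)))).
  assert (H : (Rcpow x s * w)%C = RtoC 1).
  { unfold Rcpow, Cexp, w, RtoC. destruct s as [a b]. simpl.
    replace (a * ln x - b * 0) with (a * ln x) by ring.
    replace (a * 0 + b * ln x) with (b * ln x) by ring.
    replace (- a * ln x) with (- (a * ln x)) by ring. rewrite exp_Ropp.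
    pose proof (exp_pos (a * ln x)) as He.
    pose proof (sin2_cos2 (b * ln x)) as H. unfold Rsqr in H.
    unfold Cmult; simpl. f_equal; [|field; lra].
    rewrite <- H. field. lra. }
  assert (Hz : Rcpow x s <> RtoC 0).
  { intros E. rewrite E, Cmult_0_l in H. injection H. lra. }
  rewrite <- H. field. exact Hz.
Qed.

Lemma inv_Rcpow_abs (x : R) (s : C) :
  Rabs (Re (RtoC 1 / Rcpow x s)%C) <= exp (- Re s * ln x) /\
  Rabs (Im (RtoC 1 / Rcpow x s)%C) <= exp (- Re s * ln x).
Proof.
  rewrite inv_Rcpow. simpl. pose proof (exp_pos (- Re s * ln x)).
  rewrite Rabs_Ropp, !Rabs_mult, (Rabs_pos_eq (exp _)) by lra.
  assert (Rabs (cos (Im s * ln x)) <= 1) by (apply Rabs_le, COS_bound).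
  assert (Rabs (sin (Im s * ln x)) <= 1) by (apply Rabs_le, SIN_bound).
  split; nra.
Qed.

Lemma exp_INR_ln (x : R) (p : nat) : 0 < x -> exp (INR p * ln x) = x ^ p.
Proof. intros H. rewrite <- Rpower_pow by exact H. reflexivity. Qed.

Lemma inv_Rcpow_shift (x : R) (s : C) (p : nat) : 0 < x ->
  (RtoC 1 / Rcpow x (s - RtoC (INR p)))%C = (RtoC (x ^ p) * (RtoC 1 / Rcpow x s))%C.
Proof.
  intros Hx. rewrite !inv_Rcpow. destruct s as [a b]. simpl.
  replace (- (a + - INR p) * ln x) with (INR p * ln x + - a * ln x) by ring.
  rewrite exp_plus, exp_INR_ln, Ropp_0, Rplus_0_r by exact Hx.
  unfold Cmult, RtoC; simpl. f_equal; ring.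
Qed.

Lemma RtoC_mult_parts (a : R) (z : C) : (RtoC a * z)%C = (a * Re z, a * Im z).
Proof. unfold Cmult, RtoC; simpl. f_equal; unfold Re, Im; ring. Qed.

Section Expansion.

Context (q : R) (Hq : 0 < q < 1).
Context (x : nat -> R) (delta : R).
Hypothesis x_pos : forall k, 0 < x k.
Hypothesis x_phase : forall k, phase q (x k) = INR (S k) * PI - delta.

Notation D := (zero_slope q x).

Context (coef : nat -> R) (p : nat -> nat) (V : nat -> R).
Hypothesis V_series : forall k, is_series (fun j => coef j * x k ^ p j) (V k).
Hypothesis coef_majorant : forall k n,
  psum (fun j => Rabs (coef j * x k ^ p j)) n <= Eq_real q (x k).

(** [V k] is the value at the zero of the companion function, [Cos_q] or [Sin_q]. The outer signs of
    the zeta and eta functions are left out and restored in the final theorem. *)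
Definition zeta_term (s : C) (k : nat) : C :=
  (RtoC (V k) / RtoC (D k) * (RtoC 1 / Rcpow (x k) s))%C.
Definition eta_term (s : C) (k : nat) : C :=
  (RtoC 1 / Rcpow (x k) s * (RtoC 1 / RtoC (D k)))%C.

Lemma zero_slope_neq_0 (k : nat) : D k <> 0.
Proof.
  pose proof (kernel_inf_le q Hq x delta x_pos x_phase k).
  pose proof (kernel_inf_pos q Hq x x_pos).
  pose proof (x_pos k). unfold zero_slope.
  apply Rmult_integral_contrapositive_currified; [apply pow_nonzero; lra|].
  apply Rgt_not_eq, Rmult_lt_0_compat; [apply exp_pos|apply Rdiv_lt_0_compat; lra].
Qed.

Lemma zeta_term_parts (s : C) (k : nat) :
  zeta_term s k = (RtoC (V k * / D k) * (RtoC 1 / Rcpow (x k) s))%C.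
Proof.
  unfold zeta_term. now rewrite <- RtoC_div by apply zero_slope_neq_0.
Qed.

Lemma eta_term_shift (s : C) (j k : nat) :
  eta_term (s - RtoC (INR j)) k
    = (RtoC (x k ^ j * / D k) * (RtoC 1 / Rcpow (x k) s))%C.
Proof.
  unfold eta_term. rewrite inv_Rcpow_shift by apply x_pos.
  rewrite <- RtoC_div by apply zero_slope_neq_0.
  unfold Rdiv. rewrite Rmult_1_l, RtoC_mult. ring.
Qed.

Lemma value_le_majorant (k : nat) : Rabs (V k) <= Eq_real q (x k).
Proof.
  assert (H := proj1 (psum_lim _ _) (V_series k)).
  apply (is_lim_seq_abs _ (Finite (V k))) in H.
  apply (is_lim_seq_le _ (fun _ => Eq_real q (x k)) (Rabs (V k)) (Eq_real q (x k))
           (fun n => Rle_trans _ _ _ (psum_abs _ n) (coef_majorant k n)) H).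
  apply is_lim_seq_const.
Qed.

(** Built on [Eq_real] rather than [V k], so that it also dominates all partial sums over [j] of the
    double series. *)
Definition dominant (s : C) (k : nat) : R :=
  Eq_real q (x k) * Rabs (/ D k) * exp (- Re s * ln (x k)).

Lemma ex_series_dominant (s : C) : 1 < Re s -> ex_series (dominant s).
Proof.
  intros Hs. set (K := exp (kernel_sup q) / kernel_inf q x).
  apply (ex_series_abs_le _ (fun k => K * exp (- (Re s - 1) * ln (x k)))).
  - intros k. unfold dominant.
    assert (H0 : 0 <= Eq_real q (x k)).
    { eapply Rle_trans; [apply Rabs_pos|apply value_le_majorant]. }
    pose proof (Rabs_pos (/ D k)). pose proof (exp_pos (- Re s * ln (x k))).
    rewrite Rabs_pos_eq by (apply Rmult_le_pos; nra).
    replace (- (Re s - 1) * ln (x k)) with (ln (x k) + - Re s * ln (x k)) by ring.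
    rewrite exp_plus, exp_ln, <- Rmult_assoc by apply x_pos.
    apply Rmult_le_compat_r; [lra|].
    now apply (majorant_slope_bound q Hq x delta).
  - apply (ex_series_scal_l K (fun k => exp (- (Re s - 1) * ln (x k)))).
    apply (ex_series_zero_power q Hq x delta x_pos x_phase). lra.
Qed.

Lemma zeta_term_correct (s : C) : 1 < Re s ->
  is_Cseries (zeta_term s) (CSeries (zeta_term s)).
Proof.
  intros Hs. apply (CSeries_correct _ (dominant s)); [now apply ex_series_dominant|].
  intros k. rewrite zeta_term_parts, RtoC_mult_parts. simpl.
  rewrite !Rabs_mult. unfold dominant.
  pose proof (value_le_majorant k). destruct (inv_Rcpow_abs (x k) s) as [H1 H2].
  split; (apply Rmult_le_compat;
    [apply Rmult_le_pos; apply Rabs_pos|apply Rabs_pos| |assumption]);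
    apply Rmult_le_compat_r; auto using Rabs_pos.
Qed.

Lemma eta_term_correct (s : C) : is_Cseries (eta_term s) (CSeries (eta_term s)).
Proof.
  (* Once Re s + m > 0, the power x^(-(Re s + m)) is largest at the first zero; [c] is its value
     there, and x^(- Re s) <= c x^m at all zeros. *)
  destruct (INR_unbounded (- Re s)) as [m Hm].
  destruct (power_slope_bound q Hq x delta x_pos x_phase m) as [K HK].
  set (c := exp (- (Re s + INR m) * ln (x 0%nat))).
  apply (CSeries_correct _ (fun k => c * (K * / x k))).
  - apply (ex_series_scal_l c (fun k => K * / x k)), (ex_series_scal_l K (fun k => / x k)).
    now apply (ex_series_zero_inv q Hq x delta).
  - intros k.
    assert (E : eta_term s k = (RtoC (/ D k) * (RtoC 1 / Rcpow (x k) s))%C).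
    { unfold eta_term. rewrite <- RtoC_div by apply zero_slope_neq_0.
      unfold Rdiv. rewrite Rmult_1_l. ring. }
    rewrite E, RtoC_mult_parts. simpl. rewrite !Rabs_mult.
    assert (Hexp : exp (- Re s * ln (x k)) <= c * x k ^ m).
    { rewrite <- exp_INR_ln by apply x_pos. unfold c. rewrite <- exp_plus.
      assert (Hl : ln (x 0%nat) <= ln (x k)).
      { apply ln_le; [apply x_pos|now apply (zero_ge_first q Hq x delta)]. }
      assert (Hle : - Re s * ln (x k)
        <= - (Re s + INR m) * ln (x 0%nat) + INR m * ln (x k)) by nra.
      destruct Hle as [Hle| ->]; [apply Rlt_le, exp_increasing, Hle|lra]. }
    assert (Hb : Rabs (/ D k) * exp (- Re s * ln (x k)) <= c * (K * / x k)).
    { apply Rle_trans with (Rabs (/ D k) * (c * x k ^ m)).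
      - apply Rmult_le_compat_l; [apply Rabs_pos|exact Hexp].
      - replace (Rabs (/ D k) * (c * x k ^ m)) with (c * (x k ^ m * Rabs (/ D k))) by ring.
        apply Rmult_le_compat_l; [apply Rlt_le, exp_pos|apply HK]. }
    destruct (inv_Rcpow_abs (x k) s) as [H1 H2].
    split; (eapply Rle_trans; [apply Rmult_le_compat_l; [apply Rabs_pos|]|exact Hb]);
      assumption.
Qed.

(** The weight [w] stands for the real or the imaginary part of x^(-s), both of which satisfy the
    same bound. *)
Lemma expansion_part (s : C) (w : nat -> R) : 1 < Re s ->
  (forall k, Rabs (w k) <= exp (- Re s * ln (x k))) ->
  is_series (fun j => coef j * Series (fun k => x k ^ p j * / D k * w k))
            (Series (fun k => V k * / D k * w k)).
Proof.
  intros Hs Hw.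
  apply (is_series_ext (fun j => Series (fun k => coef j * x k ^ p j * (/ D k * w k)))).
  { intros j. rewrite <- Series_scal_l. apply Series_ext. intros k. simpl. ring. }
  rewrite (Series_ext _ (fun k => V k * (/ D k * w k))) by (intros; ring).
  apply (Series_exchange _ _ (dominant s)); [now apply ex_series_dominant| |].
  - intros n k.
    rewrite (psum_ext _ (fun j => Rabs (/ D k * w k) * Rabs (coef j * x k ^ p j)))
      by (intros; rewrite Rabs_mult; ring).
    rewrite psum_scal, Rabs_mult. unfold dominant.
    replace (Eq_real q (x k) * Rabs (/ D k) * exp (- Re s * ln (x k)))
      with (Rabs (/ D k) * exp (- Re s * ln (x k)) * Eq_real q (x k)) by ring.
    pose proof (Rabs_pos (/ D k)). pose proof (Rabs_pos (w k)).
    apply Rmult_le_compat; [nra| |apply Rmult_le_compat_l; auto|apply coef_majorant].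
    rewrite <- (Rmult_0_r (INR n)), <- psum_const. apply psum_le. intros; apply Rabs_pos.
  - intros k. apply (is_series_scal_r (/ D k * w k) _ (V k)), V_series.
Qed.

Lemma expansion (s : C) : 1 < Re s ->
  is_Cseries (fun j => RtoC (coef j) * CSeries (eta_term (s - RtoC (INR (p j)))))%C
             (CSeries (zeta_term s)).
Proof.
  intros Hs. apply is_Cseries_parts.
  - apply (is_series_ext (fun j => coef j * Series (fun k => x k ^ p j * / D k *
                               Re (RtoC 1 / Rcpow (x k) s)%C))).
    + intros j. rewrite RtoC_mult_parts. apply (f_equal (Rmult (coef j))), Series_ext.
      intros k. now rewrite eta_term_shift, RtoC_mult_parts.
    + replace (Re (CSeries (zeta_term s)))
        with (Series (fun k => V k * / D k * Re (RtoC 1 / Rcpow (x k) s)%C)).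
      * apply (expansion_part s); [exact Hs|intros; apply inv_Rcpow_abs].
      * apply Series_ext. intros k. now rewrite zeta_term_parts, RtoC_mult_parts.
  - apply (is_series_ext (fun j => coef j * Series (fun k => x k ^ p j * / D k *
                               Im (RtoC 1 / Rcpow (x k) s)%C))).
    + intros j. rewrite RtoC_mult_parts. apply (f_equal (Rmult (coef j))), Series_ext.
      intros k. now rewrite eta_term_shift, RtoC_mult_parts.
    + replace (Im (CSeries (zeta_term s)))
        with (Series (fun k => V k * / D k * Im (RtoC 1 / Rcpow (x k) s)%C)).
      * apply (expansion_part s); [exact Hs|intros; apply inv_Rcpow_abs].
      * apply Series_ext. intros k. now rewrite zeta_term_parts, RtoC_mult_parts.
Qed.

(** The argument is kept as n - (n + m) because the expansion at an integer point produces this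
    form; the term is then the real number x^m / D. *)
Lemma eta_term_integer (n m : nat) :
  Series (fun k => x k ^ m / D k) = 0 ->
  CSeries (eta_term (RtoC (INR n) - RtoC (INR (n + m)))) = RtoC 0.
Proof.
  intros H.
  assert (E : forall k, eta_term (RtoC (INR n) - RtoC (INR (n + m))) k
                = RtoC (x k ^ m / D k)).
  { intros k.
    replace (RtoC (INR n) - RtoC (INR (n + m)))%C with (RtoC 0 - RtoC (INR m))%C
      by (rewrite plus_INR, RtoC_plus; ring).
    rewrite eta_term_shift, inv_Rcpow. simpl.
    rewrite !Rmult_0_l, sin_0, cos_0, Ropp_0, Rmult_0_l, exp_0.
    unfold Cmult, RtoC; simpl. f_equal; unfold Rdiv; ring. }
  unfold CSeries. rewrite (Series_ext _ _ (fun k => f_equal Re (E k))),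
    (Series_ext _ _ (fun k => f_equal Im (E k))).
  simpl. rewrite H. unfold RtoC. f_equal.
  apply is_series_unique, psum_lim.
  apply is_lim_seq_ext with (fun _ => 0); [|apply is_lim_seq_const].
  intros i. rewrite psum_const. ring.
Qed.

End Expansion.

(** * Zeros as level points of the phase *)

Lemma increasing_lt (u : nat -> R) (j k : nat) :
  (forall k, u k < u (S k)) -> (j < k)%nat -> u j < u k.
Proof.
  intros Hu H. induction H as [|k H IH]; [apply Hu|].
  eapply Rlt_trans; [exact IH|apply Hu].
Qed.

(** Strong induction: [u k] occurs as some [v i], and [i < k] would give [u i = v i = u k]. Hence
    [v k <= u k], and the converse holds by symmetry. *)
Lemma increasing_enum_unique (u v : nat -> R) :
  (forall k, u k < u (S k)) -> (forall k, v k < v (S k)) ->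
  (forall k, exists m, u k = v m) -> (forall m, exists k, v m = u k) ->
  forall k, u k = v k.
Proof.
  intros Hu Hv Huv Hvu k. induction k as [k IH] using lt_wf_ind.
  assert (Hmin : forall (f g : nat -> R) (i : nat), (forall k, f k < f (S k)) ->
    (forall k, g k < g (S k)) -> (forall j, (j < k)%nat -> f j = g j) ->
    f k = g i -> g k <= f k).
  { intros f g i Hf Hg Hfg E. destruct (lt_eq_lt_dec i k) as [[H|H]|H].
    - pose proof (increasing_lt f i k Hf H). rewrite (Hfg i H) in *. lra.
    - subst. lra.
    - pose proof (increasing_lt g k i Hg H). lra. }
  destruct (Huv k) as [i Hi]. destruct (Hvu k) as [j Hj].
  apply Rle_antisym.
  - apply (Hmin v u j); auto. intros l Hl. symmetry. auto.
  - apply (Hmin u v i); auto.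
Qed.

(** Sequence and levels enumerate the same set increasingly, so no zero is skipped. The bounds on
    [delta] make [PI - delta] the first positive level. *)
Lemma positive_zeros_phase (q : R) (Hq : 0 < q < 1) (delta : R) (f : C -> C) (x : nat -> R) :
  0 <= delta < PI ->
  (forall y, f (RtoC y) = RtoC (phase_sine q delta y)) ->
  positive_zeros f x ->
  (forall k, 0 < x k) /\ (forall k, phase q (x k) = INR (S k) * PI - delta).
Proof.
  intros Hd Hf [Hinc Hz].
  assert (Hpos : forall k, 0 < x k) by (intros k; apply (Hz (x k)); now exists k).
  split; [exact Hpos|].
  apply (increasing_enum_unique (fun k => phase q (x k)) (fun k => INR (S k) * PI - delta)).
  - intros k. apply phase_increasing; auto.
  - intros k. rewrite (S_INR (S k)). pose proof PI_RGT_0. lra.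
  - intros k. destruct (proj2 (Hz (x k)) (ex_intro _ k eq_refl)) as [_ E].
    rewrite Hf in E. injection E as E. unfold phase_sine in E.
    apply Rmult_integral in E. destruct E as [E|E].
    { pose proof (exp_pos (qseries q half_ln (x k))). unfold modulus in E. lra. }
    apply sin_eq_0_0 in E. destruct E as [z Ez].
    assert (Hph : 0 < phase q (x k)).
    { rewrite <- (phase_0 q). apply phase_increasing; auto. }
    (* z pi is the phase plus [delta], positive because [x k > 0] and [delta >= 0]. *)
    assert (Hzpos : (0 < z)%Z).
    { apply lt_IZR. pose proof PI_RGT_0. nra. }
    exists (Z.to_nat z - 1)%nat.
    replace (S (Z.to_nat z - 1)) with (Z.to_nat z) by lia.
    rewrite INR_IZR_INZ, Z2Nat.id by lia. lra.
  - intros m. destruct (phase_onto q Hq (INR (S m) * PI - delta)) as (y & Hy & E).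
    + rewrite S_INR. pose proof (pos_INR m). pose proof PI_RGT_0. nra.
    + assert (Hy0 : 0 < y /\ f (RtoC y) = RtoC 0).
      { split; [exact Hy|]. rewrite Hf. f_equal. unfold phase_sine. rewrite E.
        replace (INR (S m) * PI - delta + delta) with (0 + INR (S m) * PI) by ring.
        rewrite sin_plus_nat_PI, sin_0. ring. }
      apply Hz in Hy0. destruct Hy0 as [k <-]. exists k. now symmetry.
Qed.

(** * The two cases, phase shift 0 and pi / 2 *)

Section Specialization.

Context (q : R) (Hq : 0 < q < 1).

Lemma Sin_q_phase_sine (y : R) : Sin_q q (RtoC y) = RtoC (phase_sine q 0 y).
Proof. rewrite Sin_q_real by exact Hq. unfold phase_sine. now rewrite Rplus_0_r. Qed.

Lemma Cos_q_phase_sine (y : R) : Cos_q q (RtoC y) = RtoC (phase_sine q (PI / 2) y).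
Proof.
  rewrite Cos_q_real by exact Hq. unfold phase_sine.
  rewrite Rplus_comm, <- cos_sin. reflexivity.
Qed.

Lemma poly_recurrence :
  (forall n, qb q n <> 0) /\
  (forall y, poly_re q 0 y = 1 /\ poly_im q 0 y = 0) /\
  (forall N y, poly_re q (S N) y = poly_re q N y - qb q N * y * poly_im q N y) /\
  (forall N y, poly_im q (S N) y = poly_im q N y + qb q N * y * poly_re q N y).
Proof.
  split; [intros n; apply Rgt_not_eq, qb_pos, Hq|].
  split; [|split; intros; [apply poly_re_S|apply poly_im_S]].
  intros y. unfold poly_re, poly_im, qsum. simpl. rewrite exp_0, cos_0, sin_0.
  split; ring.
Qed.

Lemma Sin_zeros_sum (x : nat -> R) (m : nat) :
  (forall k, 0 < x k) -> (forall k, phase q (x k) = INR (S k) * PI - 0) ->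
  Series (fun k => x k ^ (2 * m + 2) / zero_slope q x k) = 0.
Proof.
  intros x_pos x_phase. destruct poly_recurrence as (Hb & H0 & Hre & Him).
  (* The gap condition reads (2M + 1) pi / 2 = M pi + pi / 2; starting at [m + 2] ensures the degree
     condition m + 1 < M. *)
  apply (termination q Hq x 0 x_pos x_phase _ (fun M => S (2 * M)) (m + 2)).
  - intros; lia.
  - intros M. rewrite S_INR, mult_INR. simpl (INR 2). field.
  - intros M r d HM Hinj Hr.
    apply (PolynomialRoots.residue_sum_im Hb H0 Hre Him Hinj (m := m) ltac:(lia) eq_refl).
    intros k Hk. destruct (Hr k Hk) as (Hpos & Hzero & Hder).
    assert (E : forall y, trunc_sine q 0 (S (2 * M)) y = poly_im q (S (2 * M)) y).
    { intros y. unfold trunc_sine, poly_im. now rewrite Rplus_0_r. }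
    split; [exact Hpos|]. split; [now rewrite <- E|].
    exact (is_derive_ext _ _ _ _ E Hder).
Qed.

Lemma Cos_zeros_sum (x : nat -> R) (m : nat) :
  (forall k, 0 < x k) -> (forall k, phase q (x k) = INR (S k) * PI - PI / 2) ->
  Series (fun k => x k ^ (2 * m + 1) / zero_slope q x k) = 0.
Proof.
  intros x_pos x_phase. destruct poly_recurrence as (Hb & H0 & Hre & Him).
  (* With [delta = PI / 2] the two half turns cancel, so an even number of factors is taken. *)
  apply (termination q Hq x (PI / 2) x_pos x_phase _ (fun M => 2 * M)%nat (m + 2)).
  - intros; lia.
  - intros M. rewrite mult_INR. simpl (INR 2). field.
  - intros M r d HM Hinj Hr.
    apply (PolynomialRoots.residue_sum_re Hb H0 Hre Him Hinj (m := m) ltac:(lia) eq_refl).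
    intros k Hk. destruct (Hr k Hk) as (Hpos & Hzero & Hder).
    assert (E : forall y, trunc_sine q (PI / 2) (2 * M) y = poly_re q (2 * M) y).
    { intros y. unfold trunc_sine, poly_re.
      now rewrite (Rplus_comm _ (PI / 2)), <- cos_sin. }
    split; [exact Hpos|]. split; [now rewrite <- E|].
    exact (is_derive_ext _ _ _ _ E Hder).
Qed.

End Specialization.

Lemma CSeries_ext (a b : nat -> C) : (forall k, a k = b k) -> CSeries a = CSeries b.
Proof.
  intros H. unfold CSeries. f_equal; apply Series_ext; intros k; now rewrite H.
Qed.

Lemma is_Cseries_ext (a b : nat -> C) (l : C) :
  (forall k, a k = b k) -> is_Cseries a l -> is_Cseries b l.
Proof. exact (is_series_ext a b l). Qed.

Theorem theorem6p3 :
  forall (q : R) (xi eta : nat -> R),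
    0 < q < 1 ->
    positive_zeros (Sin_q q) xi ->
    positive_zeros (Cos_q q) eta ->
    (* the series defining the four functions converge *)
    (forall s : C, 1 < Re s ->
       ex_Cseries (zeta_q_term q xi s) /\
       ex_Cseries (zeta_q_star_term q eta s)) /\
    (forall s : C,
       ex_Cseries (eta_q_term q xi s) /\
       ex_Cseries (eta_q_star_term q eta s)) /\
    (* the expansions for Re s > 1 *)
    (forall s : C, 1 < Re s ->
       is_Cseries (zeta_q_exp q xi s) (zeta_q q xi s) /\
       is_Cseries (zeta_q_star_exp q eta s) (zeta_q_star q eta s)) /\
    (* they terminate at s = 2n *)
    (forall n : nat, (1 <= n)%nat ->
       zeta_q q xi (RtoC (INR (2 * n)))
         = sum_n (zeta_q_exp q xi (RtoC (INR (2 * n)))) n /\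
       zeta_q_star q eta (RtoC (INR (2 * n)))
         = sum_n (zeta_q_star_exp q eta (RtoC (INR (2 * n)))) (n - 1)).
Proof.
  intros q xi eta Hq Hxi Heta. assert (HPI := PI_RGT_0).
  destruct (positive_zeros_phase q Hq 0 _ xi ltac:(lra) (Sin_q_phase_sine q Hq) Hxi)
    as [xi_pos xi_phase].
  destruct (positive_zeros_phase q Hq (PI / 2) _ eta ltac:(lra) (Cos_q_phase_sine q Hq) Heta)
    as [eta_pos eta_phase].
  assert (HDxi : forall k, C_derive (Sin_q q) (RtoC (xi k)) = RtoC (zero_slope q xi k)).
  { intros k. apply (C_derive_real _ _ _ _ (Sin_q_phase_sine q Hq)).
    now apply phase_sine_slope. }
  assert (HDeta : forall k, C_derive (Cos_q q) (RtoC (eta k)) = RtoC (zero_slope q eta k)).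
  { intros k. apply (C_derive_real _ _ _ _ (Cos_q_phase_sine q Hq)).
    now apply phase_sine_slope. }
  set (Vxi := fun k => modulus q (xi k) * cos (phase q (xi k))).
  set (Veta := fun k => modulus q (eta k) * sin (phase q (eta k))).
  assert (HVxi : forall k, is_series (fun j => Cos_coef q j * xi k ^ (2 * j)) (Vxi k)).
  { intros k. apply Cos_q_series; [exact Hq|]. apply Rlt_le, xi_pos. }
  assert (HVeta : forall k,
    is_series (fun j => Sin_coef q j * eta k ^ (2 * j + 1)) (Veta k)).
  { intros k. apply Sin_q_series; [exact Hq|]. apply Rlt_le, eta_pos. }
  assert (HMxi : forall k n,
    psum (fun j => Rabs (Cos_coef q j * xi k ^ (2 * j))) n <= Eq_real q (xi k)).
  { intros k n. apply Cos_majorant; [exact Hq|]. apply Rlt_le, xi_pos. }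
  assert (HMeta : forall k n,
    psum (fun j => Rabs (Sin_coef q j * eta k ^ (2 * j + 1))) n <= Eq_real q (eta k)).
  { intros k n. apply Sin_majorant; [exact Hq|]. apply Rlt_le, eta_pos. }
  assert (Ezeta : forall s k, zeta_term q xi Vxi s k = zeta_q_term q xi s k).
  { intros s k. unfold zeta_q_term. now rewrite HDxi, Cos_q_real. }
  assert (Ezeta' : forall s k, zeta_term q eta Veta s k = zeta_q_star_term q eta s k).
  { intros s k. unfold zeta_q_star_term. now rewrite HDeta, Sin_q_real. }
  assert (Eeta : forall s k, eta_term q xi s k = eta_q_term q xi s k).
  { intros s k. unfold eta_q_term. now rewrite HDxi. }
  assert (Eeta' : forall s k, eta_term q eta s k = eta_q_star_term q eta s k).
  { intros s k. unfold eta_q_star_term. now rewrite HDeta. }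
  (* The extra sign in (-1)^(j + 1) cancels the minus in the definition of [eta_q]. *)
  assert (Eexp : forall s j, (RtoC (Cos_coef q j) *
      CSeries (eta_term q xi (s - RtoC (INR (2 * j)))))%C = zeta_q_exp q xi s j).
  { intros s j. unfold zeta_q_exp, eta_q.
    rewrite (CSeries_ext _ _ (Eeta (s - RtoC (INR (2 * j)))%C)).
    unfold Cos_coef. rewrite (proj1 (Eq_coef_closed q Hq j)).
    replace ((-1) ^ (j + 1) / qfact q (2 * j) * q ^ (j * (2 * j - 1)))
      with (- ((-1) ^ j * (q ^ (j * (2 * j - 1)) / qfact q (2 * j))))
      by (rewrite pow_add; unfold Rdiv; ring).
    rewrite RtoC_opp. ring. }
  (* Both starred functions carry a minus, so one sign stays in front of the whole expansion. *)
  assert (Eexp' : forall s j, (- (RtoC (Sin_coef q j) *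
      CSeries (eta_term q eta (s - RtoC (INR (2 * j + 1))))))%C = zeta_q_star_exp q eta s j).
  { intros s j. unfold zeta_q_star_exp, eta_q_star.
    rewrite (CSeries_ext _ _ (Eeta' (s - RtoC (INR (2 * j + 1)))%C)).
    unfold Sin_coef. rewrite (proj2 (Eq_coef_closed q Hq j)).
    replace ((-1) ^ j / qfact q (2 * j + 1) * q ^ (j * (2 * j + 1)))
      with ((-1) ^ j * (q ^ (j * (2 * j + 1)) / qfact q (2 * j + 1)))
      by (unfold Rdiv; ring).
    ring. }
  assert (Hexp : forall s, 1 < Re s -> is_Cseries (zeta_q_exp q xi s) (zeta_q q xi s)).
  { intros s Hs. apply (is_Cseries_ext _ _ _ (Eexp s)).
    unfold zeta_q. rewrite <- (CSeries_ext _ _ (Ezeta s)).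
    now apply (expansion q Hq xi 0 xi_pos xi_phase (Cos_coef q) (fun j => 2 * j)%nat). }
  assert (Hexp' : forall s, 1 < Re s ->
    is_Cseries (zeta_q_star_exp q eta s) (zeta_q_star q eta s)).
  { intros s Hs. apply (is_Cseries_ext _ _ _ (Eexp' s)).
    unfold zeta_q_star. rewrite <- (CSeries_ext _ _ (Ezeta' s)).
    apply (is_series_opp (V := C_NormedModule)).
    now apply (expansion q Hq eta (PI / 2) eta_pos eta_phase (Sin_coef q)
                 (fun j => 2 * j + 1)%nat). }
  split; [|split; [|split]].
  - intros s Hs. split.
    + exists (CSeries (zeta_term q xi Vxi s)). apply (is_Cseries_ext _ _ _ (Ezeta s)).
      now apply (zeta_term_correct q Hq xi 0 xi_pos xi_phase _ _ Vxi HVxi HMxi).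
    + exists (CSeries (zeta_term q eta Veta s)). apply (is_Cseries_ext _ _ _ (Ezeta' s)).
      now apply (zeta_term_correct q Hq eta (PI / 2) eta_pos eta_phase _ _ Veta HVeta HMeta).
  - intros s. split.
    + exists (CSeries (eta_term q xi s)). apply (is_Cseries_ext _ _ _ (Eeta s)).
      now apply (eta_term_correct q Hq xi 0).
    + exists (CSeries (eta_term q eta s)). apply (is_Cseries_ext _ _ _ (Eeta' s)).
      now apply (eta_term_correct q Hq eta (PI / 2)).
  - auto.
  - intros n Hn.
    assert (Hs : 1 < Re (RtoC (INR (2 * n)))).
    { simpl Re. change 1 with (INR 1). apply lt_INR. lia. }
    split; apply is_Cseries_finite; auto.
    + intros j Hj. rewrite <- Eexp.
      (* Past [n] the power of the zeros is even and at least 2, the range of [Sin_zeros_sum]. *)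
      assert (Ej : (2 * j = 2 * n + (2 * (j - n - 1) + 2))%nat) by lia.
      rewrite Ej.
      rewrite (eta_term_integer q Hq xi 0 xi_pos xi_phase); [ring|].
      now apply Sin_zeros_sum.
    + intros j Hj. rewrite <- Eexp'.
      (* Here [j > n - 1] with [n >= 1] means [j >= n], so the power is odd and at least 1; this is
         why the starred sum stops one term earlier. *)
      assert (Ej : (2 * j + 1 = 2 * n + (2 * (j - n) + 1))%nat) by lia.
      rewrite Ej.
      rewrite (eta_term_integer q Hq eta (PI / 2) eta_pos eta_phase); [ring|].
      now apply Cos_zeros_sum.
Qed.
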